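(* For every real $\mu>0$ there is $n_0$ such that the following holds for all $n\ge n_0$ and every positive integer $d$. If $S$ is a Steiner triple system with at least $(1+\mu)n$ vertices and $T$ is a perfect $d$-ary hypertree on at most $n$ vertices, then $T\subseteq S$, i.e. $S$ contains a subhypergraph isomorphic to $T$.
   Context: A Steiner triple system is a $3$-uniform hypergraph in which every pair of vertices is contained in exactly one edge. A hypertree is a connected, simple (linear, i.e. any two distinct edges share at most one vertex) $3$-uniform hypergraph in which every two vertices are joined by a unique path. A perfect $d$-ary hypertree of height $h$ is a hypertree $T$ with $V(T)=\bigcup_{i=0}^{h}V_i$ (the levels, which are disjoint), such that $|V_i|=(2d)^i$ for all $0\le i\le h$, and for each $0\le i\le h-1$ and each $v\in V_i$ there are $d$ edges $\{v,u_j,w_j\}$, $1\le j\le d$, with $u_j,w_j\in V_{i+1}$, that are pairwise disjoint apart from the common vertex $v$. In other words, every non-leaf vertex has exactly $2d$ children, grouped into $d$ edges (forward degree $d$). A perfect $d$-ary hypertree is a perfect $d$-ary hypertree of some height $h$. *)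

(* Defs.v *)
From HB Require Import structures.
From mathcomp Require Import all_boot all_order all_algebra.
From mathcomp Require Import reals.

Set Implicit Arguments.
Unset Strict Implicit.
Unset Printing Implicit Defensive.

Record hypergraph (V : finType) := Hypergraph {
  verts : {set V};
  edges : {set {set V}};
  edges_verts : forall e, e \in edges -> e \subset verts
}.

Definition uniform3 (V : finType) (G : hypergraph V) : Prop :=
  forall e, e \in edges G -> #|e| = 3.

Definition linear_hypergraph (V : finType) (G : hypergraph V) : Prop :=
  forall e f, e \in edges G -> f \in edges G -> e != f -> #|e :&: f| <= 1.

Definition steiner_triple_system (V : finType) (G : hypergraph V) : Prop :=
  uniform3 G /\
  forall x y, x \in verts G -> y \in verts G -> x != y ->
    exists! e : {set V}, [/\ e \in edges G, x \in e & y \in e].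

(* [:: (e1, v1); ...; (ek, vk)] encodes the walk x e1 v1 e2 v2 ... ek vk. *)
Fixpoint walk (V : finType) (G : hypergraph V) (x : V)
    (p : seq ({set V} * V)) : bool :=
  if p is (e, y) :: p' then
    [&& e \in edges G, x \in e, y \in e & walk G y p']
  else true.

(* Vertices and edges are both pairwise distinct: without the condition on
   edges, two vertices of a single triple {x, y, z} would be joined both by
   x e y and by x e z e y, and no hypergraph with an edge would be a
   hypertree. *)
Definition is_path (V : finType) (G : hypergraph V) (x y : V)
    (p : seq ({set V} * V)) : Prop :=
  [/\ walk G x p, last x (unzip2 p) = y,
      uniq (x :: unzip2 p) & uniq (unzip1 p)].

Definition connected_hypergraph (V : finType) (G : hypergraph V) : Prop :=
  forall x y, x \in verts G -> y \in verts G -> exists p, is_path G x y p.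

Definition hypertree (V : finType) (G : hypergraph V) : Prop :=
  [/\ uniform3 G, linear_hypergraph G, connected_hypergraph G &
      forall x y, x \in verts G -> y \in verts G -> x != y ->
        exists! p, is_path G x y p].

(* u <> w and u, w <> v in the last clause follow from 3-uniformity. *)
Definition perfect_hypertree_of_height (V : finType) (d h : nat)
    (T : hypergraph V) : Prop :=
  hypertree T /\
  exists L : nat -> {set V},
    [/\ verts T = \bigcup_(i < h.+1) L i,
        forall i j, i <= h -> j <= h -> i != j -> [disjoint L i & L j],
        forall i, i <= h -> #|L i| = (2 * d) ^ i &
        forall i v, i < h -> v \in L i ->
          exists M : {set {set V}},
            [/\ M \subset edges T, #|M| = d,
                forall e, e \in M -> exists u w,
                  [/\ u \in L i.+1, w \in L i.+1 & e = [set v; u; w]] &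
                forall e f, e \in M -> f \in M -> e != f ->
                  e :&: f = [set v]]].

Definition perfect_hypertree (V : finType) (d : nat) (T : hypergraph V) : Prop :=
  exists h, perfect_hypertree_of_height d h T.

Definition subhypergraph (V : finType) (H G : hypergraph V) : Prop :=
  verts H \subset verts G /\ edges H \subset edges G.

Definition isomorphic (V W : finType) (G : hypergraph V) (H : hypergraph W) : Prop :=
  exists f : V -> W,
    [/\ {in verts G &, injective f}, f @: verts G = verts H &
        [set f @: (e : {set V}) | e in edges G] = edges H].

Definition contains_copy (V W : finType) (S : hypergraph V) (T : hypergraph W) : Prop :=
  exists H : hypergraph V, subhypergraph H S /\ isomorphic T H.

(* Main.v *)
Require Import Defs.
From HB Require Import structures.
From mathcomp Require Import all_boot all_order all_algebra.
From mathcomp Require Import reals.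
From mathcomp Require Import zify ring lra.

Set Implicit Arguments.
Unset Strict Implicit.
Unset Printing Implicit Defensive.

(** A Steiner triple system on a set Q of points is encoded by the operation t
    sending x <> y to the third point t x y of their triple, with t x x = x.
    The tree is embedded level by level.  Once the image X of a level is known,
    each x in X needs d pairs {u, t x u}, all of them disjoint and made of
    unused points; the next level is the union of these pairs.  Such a choice
    is recorded by a pairing: a partial function k, where k u = Some x means
    that u serves as a child of x.

    A pairing is enlarged along an alternating chain.  Start from an unused
    point f0; if y1 = t x1 f0 is used, let f1 be the partner of y1; if
    y2 = t x2 f1 is used, let f2 be its partner, and so on until some y_n is
    unused.  Giving {f0, y1} to x1, {f1, y2} to x2, ..., and taking away the
    pairs {y1, f1}, {y2, f2}, ..., gains one pair, provided that the parents
    x_j still lacked pairs (chain_augment).  Chains exist as soon as there is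
    expansion: if, for suitable sets D of deficient parents, the points that
    some t x with x in D sends into a set Z number at least #|Z| minus a small
    error, for every Z, then the set of points from which a chain starts grows
    by a fixed amount in each round (reach_growth), so it contains an unused
    point after boundedly many rounds.

    If d is large, all levels but the last form a small part of the tree.
    Then each map t x is a permutation that sends few points to the used ones,
    so a single deficient parent x already expands; asking for slightly more
    than d pairs per parent then makes every parent reach d
    (large_degree_fan).

    If d is bounded, expansion can fail for a badly placed set of used points,
    and a random colouring of Q with a fixed number of colours repairs this.  A
    fourth moment computation yields a colouring for which, for all sets D, Z
    and every colour, the number of (x, y) in D * Z such that t x y has that
    colour is #|D| * #|Z| / #colours up to o(#|Q|^2) (mixing_colouring).  Each
    of the boundedly many levels of linear size receives two fresh blocks A1
    and A2 of equally many colours, and its pairs have one point in each.  For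
    Z inside A2, let E be the set of the points of A1 of the form t x z with x
    in D, z in Z.  The pairs (x, z) of D * Z with t x z in A1 are nearly a
    fixed proportion of D * Z, and (x, z) |-> (x, t x z) sends them injectively
    to pairs of D * E whose value lies in A2, which are at most nearly the same
    proportion of D * E; hence #|Z| <= #|E| + err (block_expansion).  The few
    parents that remain deficient, and the small levels near the root, are
    served greedily from a reserved block of colours (greedy_fill).

    On the side of the tree, uniqueness of paths shows that each vertex other
    than the root is a child of exactly one vertex, and that there are no edges
    besides the ones joining a vertex to its children (addressingP).  Vertices
    are thus determined by their parent, the number of their edge below it, and
    their place in that edge; an embedding is then built by induction on the
    level (embed_levels). *)

(** * Steiner operations, pairings and alternating chains *)

(** The operation of a Steiner triple system: the third point of the triple
    through two distinct points, extended by idempotence.  This makes t x a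
    total involution for every x. *)
Record steiner_op (Q : finType) := SteinerOp {
  third :> Q -> Q -> Q;
  thirdC : forall x y, third x y = third y x;
  thirdK : forall x, involutive (third x);
  thirdxx : forall x, third x x = x }.

Section Pairings.

Variables (Q : finType) (t : steiner_op Q).
Implicit Types (x y u f : Q) (A O X Z : {set Q}).

Lemma third_eq_r x y : (t x y == y) = (x == y).
Proof.
apply/eqP/eqP => [txy|->]; last exact: thirdxx.
have := thirdK t y x; rewrite (thirdC t y x) txy thirdxx; by move=> ->.
Qed.

Lemma third_inj x : injective (t x).
Proof. exact: inv_inj (thirdK t x). Qed.

(** [k u = Some x] says that u is used as a child of x in X, next to its partner
    t x u.  Children lie in A1 or A2, and partners lie on opposite sides.  The
    two uses are A1 = A2, where the sides say nothing, and A1 disjoint from A2,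
    where every pair has one point in each. *)
Definition pairing X A1 A2 (k : Q -> option Q) : Prop :=
  forall u x, k u = Some x ->
    [/\ x \in X, k (t x u) = Some x, t x u != u,
        u \in A1 :|: A2 &
        (u \in A1 -> t x u \in A2) /\ (u \in A2 -> t x u \in A1)].

(** The number of children of x, hence twice the number of its pairs. *)
Definition deg (k : Q -> option Q) x := #|[set u | k u == Some x]|.

(** The used points. *)
Definition supp (k : Q -> option Q) := [set u | k u != None].

(** The partner of u; an unused point is its own partner. *)
Definition sib (k : Q -> option Q) u := if k u is Some x then t x u else u.

Lemma card_supp k X A1 A2 : pairing X A1 A2 k ->
  #|supp k| = \sum_(x in X) deg k x.
Proof.
move=> Pk.
rewrite -sum1_card (partition_big (fun u => odflt u (k u)) (mem X)) /=; last first.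
  move=> u; rewrite inE; case E: (k u) => [x|] //= _.
  by case: (Pk _ _ E).
apply: eq_bigr => x xX; rewrite /deg -sum1_card; apply: eq_bigl => u.
rewrite !inE; case: (k u) => //=.
Qed.

Lemma sibK X A1 A2 k : pairing X A1 A2 k -> involutive (sib k).
Proof.
move=> Pk u; rewrite /sib; case E: (k u) => [x|]; last by rewrite E.
by have [_ -> _ _ _] := Pk _ _ E; rewrite thirdK.
Qed.

Lemma sib_eq X A1 A2 k u : pairing X A1 A2 k -> (sib k u == u) = (k u == None).
Proof.
move=> Pk; rewrite /sib; case E: (k u) => [x|]; last by rewrite eqxx.
by have [_ _ /negbTE -> _ _] := Pk _ _ E.
Qed.

Lemma supp_sib X A1 A2 k u : pairing X A1 A2 k -> (sib k u \in supp k) = (u \in supp k).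
Proof.
move=> Pk; rewrite /sib !inE; case E: (k u) => [x|]; last by rewrite E.
by have [_ -> _ _ _] := Pk _ _ E.
Qed.

(** [chain a k A2 f s]: f starts an alternating chain using the parents s in
    that order; the chain stops at the first unused point, and the rest of s is
    then ignored.  The predicate a holds at the points f_j and fails at the
    points y_j of the chain, so that no point occurs in both roles. *)
Fixpoint chain (a : pred Q) (k : Q -> option Q) A2 f (s : seq Q) : bool :=
  if s is x :: s' then
    [&& a f, t x f \in A2, ~~ a (t x f) &
      (k (t x f) == None) || chain a k A2 (sib k (t x f)) s']
  else false.

(** Give the pair {f, t x f} to x. *)
Definition insert_pair (k : Q -> option Q) x f (u : Q) :=
  if (u == f) || (u == t x f) then Some x else k u.

Lemma pairing_insert X A1 A2 k x f : pairing X A1 A2 k ->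
  k f = None -> k (t x f) = None -> x \in X -> t x f != f ->
  f \in A1 -> t x f \in A2 -> A1 = A2 \/ [disjoint A1 & A2] ->
  pairing X A1 A2 (insert_pair k x f).
Proof.
move=> Pk kf ky xX yf fA yA sides u z; rewrite /insert_pair.
case: (eqVneq u f) => [->|uf] /=.
  case=> <-; rewrite eqxx orbT inE fA; split => //; split => // fA2.
  by case: sides => [->//|/disjointFr/(_ fA)]; rewrite fA2.
case: (eqVneq u (t x f)) => [->|uy] /=.
  case=> <-; rewrite thirdK eqxx eq_sym yf inE yA orbT; split => //; split => // yA1.
  by case: sides => [<-//|/disjointFr/(_ yA1)]; rewrite yA.
move=> /[dup] kuz /Pk [zX ku tu uA uside]; split => //.
case: eqP => [e|_] /=; first by rewrite -e ku in kf.
by case: eqP => [e|//]; rewrite -e ku in ky.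
Qed.

Lemma deg_insert k x f z : deg (insert_pair k x f) z <= deg k z + (x == z).*2.
Proof.
rewrite /deg /insert_pair; case: (eqVneq x z) => [->|xz].
  apply: (@leq_trans #|[set u | k u == Some z] :|: [set f; t z f]|).
    apply: subset_leq_card; apply/subsetP => u; rewrite !inE.
    by case: (_ || _); rewrite ?orbT ?orbF.
  rewrite cardsU; apply: leq_trans (leq_subr _ _) _; rewrite leq_add2l.
  by rewrite cards2; case: (_ != _).
rewrite addn0; apply: subset_leq_card; apply/subsetP => u; rewrite !inE.
by case: ifP => // _ /eqP[] e; rewrite e eqxx in xz.
Qed.

Lemma supp_insert k x f : supp (insert_pair k x f) = [set f; t x f] :|: supp k.
Proof. by apply/setP => u; rewrite !inE /insert_pair; case: (_ || _). Qed.

Lemma card_supp_insert k x f : k f = None -> 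
  #|supp k| < #|supp (insert_pair k x f)|.
Proof.
move=> kf; rewrite supp_insert; apply: proper_card; apply/properP; split; first exact: subsetUr.
by exists f; rewrite !inE ?kf ?eqxx.
Qed.

(** Forget the pair of y. *)
Definition delete_pair (k : Q -> option Q) y (u : Q) :=
  if (u == y) || (u == sib k y) then None else k u.

Lemma pairing_delete X A1 A2 k y : pairing X A1 A2 k -> pairing X A1 A2 (delete_pair k y).
Proof.
move=> Pk u z; rewrite /delete_pair; case: ifP => // /norP[uy usy] /[dup] kuz /Pk[zX ku tu uA uside].
split => //; rewrite ifN // negb_or.
have su : sib k u = t z u by rewrite /sib kuz.
apply/andP; split; apply/eqP; rewrite -su => e; first by rewrite -e (sibK Pk) eqxx in usy.
by move: uy; rewrite (inv_inj (sibK Pk) e) eqxx.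
Qed.

Lemma deg_delete k y z : deg (delete_pair k y) z <= deg k z.
Proof.
apply: subset_leq_card; apply/subsetP => u; rewrite !inE /delete_pair.
by case: ifP.
Qed.

(** The first step of a chain: x takes the pair {f, t x f}, and the former
    partner of t x f becomes unused. *)
Definition switch k x f := insert_pair (delete_pair k (t x f)) x f.

(** A chain starting elsewhere survives the switch at y = t x f unless it passes
    through y again; in that case its part after y is a shorter chain, which
    starts at the partner of y. *)
Lemma chain_switch a k A2 x f g s :
  ~~ a (t x f) -> a f -> a (sib k (t x f)) -> k (t x f) != None ->
  chain a k A2 g s ->
  chain a (switch k x f) A2 g s \/
  exists s', [/\ size s' < size s, forall z, count_mem z s' <= count_mem z s
              & chain a k A2 (sib k (t x f)) s'].
Proof.
move=> ay af af1 ky; elim: s g => //= x2 s IH g /and4P[ag yA ay2].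
have [e|ne] := eqVneq (t x2 g) (t x f).
  rewrite e (negbTE ky) /= => ch; right; exists s; split => // z; exact: leq_addl.
have kk : switch k x f (t x2 g) = k (t x2 g).
  rewrite /switch /insert_pair /delete_pair (negbTE ne) orbF /=.
  rewrite ifN; last by apply: contraNneq ay2 => ->.
  by rewrite ifN //; apply: contraNneq ay2 => ->.
rewrite ag yA ay2 /= {2}/sib kk -/(sib k (t x2 g)).
case: (eqVneq (k (t x2 g)) None) => [_ _|_ /= /IH[->|]]; [by left|by left|].
case=> s' [ss cs ch]; right; exists s'; split => //; first by lia.
by move=> z; rewrite (leq_trans (cs z)) ?leq_addl.
Qed.

(** An alternating chain gains one pair.  The degree bound asks each parent to
    lack as many pairs as it has occurrences in the chain. *)
Lemma chain_augment X A1 A2 a k f s (cap : nat) :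
  A1 = A2 \/ [disjoint A1 & A2] ->
  pairing X A1 A2 k -> f \in A1 -> k f = None -> chain a k A2 f s ->
  {subset s <= X} -> (forall z, deg k z + (count_mem z s).*2 <= cap) ->
  exists k', [/\ pairing X A1 A2 k', forall z, deg k' z <= cap & #|supp k| < #|supp k'|].
Proof.
move=> sides.
have [n] := ubnP (size s); elim: n s k f => // n IH s k f lesn Pk fA kf ch sX dk.
case: s lesn ch sX dk => //= x s lesn /and4P[af yA ay ch] sX dk.
have xX : x \in X by apply: sX; rewrite inE eqxx.
have yf : t x f != f by apply: contraNneq ay => ->.
have [ky|ky] := eqVneq (k (t x f)) None.
  exists (insert_pair k x f); split; last exact: card_supp_insert.
  - exact: pairing_insert.
  - move=> z; apply: leq_trans (deg_insert _ _ _ _) _; apply: leq_trans (dk z).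
    by rewrite leq_add2l leq_double leq_addr.
move: ch; rewrite (negbTE ky) /= => ch.
have af1 : a (sib k (t x f)) by case: s {lesn sX dk} ch => //= ? ? /andP[].
have [ch'|[s' [ss cs ch']]] := chain_switch ay af af1 ky ch; last first.
  (* The chain returns to y = t x f: cut the loop. *)
  apply: (IH (x :: s') k f) => //=; first exact: leq_ltn_trans ss lesn.
  - by rewrite af yA ay ch' orbT.
  - move=> z; rewrite inE => /predU1P[->//|zs]; apply: sX; rewrite inE.
    move: zs; rewrite -has_pred1 has_count => /leq_trans/(_ (cs z)).
    by rewrite -has_count has_pred1 => ->; rewrite orbT.
  - by move=> z; apply: leq_trans (dk z); rewrite leq_add2l leq_double leq_add2l.
have df : delete_pair k (t x f) f = None by rewrite /delete_pair kf if_same.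
have dy : delete_pair k (t x f) (t x f) = None by rewrite /delete_pair eqxx.
have Pd : pairing X A1 A2 (delete_pair k (t x f)) by exact: pairing_delete.
have P1 : pairing X A1 A2 (switch k x f) by exact: pairing_insert.
have kf1 : k (sib k (t x f)) != None.
  by have := supp_sib (t x f) Pk; rewrite !inE => ->.
have f1f : sib k (t x f) != f by apply: contraNneq kf1 => ->; rewrite kf.
have f1y : sib k (t x f) != t x f by rewrite (sib_eq _ Pk).
have f1A : sib k (t x f) \in A1.
  rewrite /sib; case E: (k (t x f)) => [p|]; last by rewrite E in ky.
  by have [_ _ _ _ [_]] := Pk _ _ E; apply.
have k1f1 : switch k x f (sib k (t x f)) = None.
  rewrite /switch /insert_pair (negbTE f1f) (negbTE f1y) /= /delete_pair eqxx.
  by rewrite orbT.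
have s1X : {subset s <= X} by move=> z zs; apply: sX; rewrite inE zs orbT.
have d1 z : deg (switch k x f) z + (count_mem z s).*2 <= cap.
  apply: leq_trans (dk z); rewrite doubleD addnA leq_add2r.
  by apply: leq_trans (deg_insert _ _ _ _) _; rewrite leq_add2r deg_delete.
have [k' [Pk' dk' sk']] := IH _ _ _ lesn P1 f1A k1f1 ch' s1X d1.
exists k'; split => //; apply: leq_ltn_trans sk'.
rewrite supp_insert; set S := [set f; _] :|: _.
have <- : #|(f |: supp k) :\ sib k (t x f)| = #|supp k|.
  by apply/eqP; rewrite -eqSS -[X in X == _]add1n; have := cardsD1 (sib k (t x f)) (f |: supp k);
     rewrite in_setU !inE kf1 orbT cardsU1 !inE kf /= => <-.
apply: subset_leq_card; apply/subsetP => u; rewrite !inE /delete_pair.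
case: (eqVneq u f) => [->|] //=; case: (eqVneq u (t x f)) => [->|] //=.
by case: (u == sib _ _).
Qed.

(** The points of A1 from which a chain of at most j steps starts, whose first
    parent is in D (j - 1), the second in D (j - 2), and so on. *)
Fixpoint reach (D : nat -> {set Q}) A1 A2 (k : Q -> option Q) (j : nat) : {set Q} :=
  if j is i.+1 then
    [set f in A1 | [exists x in D i, (t x f \in A2) &&
       ((k (t x f) == None) || (sib k (t x f) \in reach D A1 A2 k i))]]
  else set0.

Lemma reach_sub D A1 A2 k j : reach D A1 A2 k j \subset A1.
Proof. by case: j => [|j]; [exact: sub0set|apply/subsetP => f; rewrite inE => /andP[]]. Qed.

(** With disjoint sides, membership in A1 separates the two roles in a chain. *)
Lemma reach_chain D A1 A2 k j f : [disjoint A1 & A2] ->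
  f \in reach D A1 A2 k j ->
  exists s, chain (mem A1) k A2 f s /\ forall z, count_mem z s <= \sum_(i < j) (z \in D i).
Proof.
move=> dA; elim: j f => [|j IH] f /=; first by rewrite inE.
rewrite inE => /andP[fA /existsP[x /and3P[xD yA kf]]].
have ay : t x f \notin A1 by rewrite (disjointFl dA).
case: eqP kf => [ky _|ky /= /IH[s [ch cs]]].
  exists [:: x]; split => [|z]; first by rewrite /= fA yA ay ky.
  by rewrite big_ord_recr /= addn0; case: eqP => [<-|//]; rewrite xD leq_addl.
exists (x :: s); split => [|z]; first by rewrite /= fA yA ay ch orbT.
rewrite big_ord_recr /= addnC leq_add //; by case: eqP => [<-|//]; rewrite xD.
Qed.

(** With one side and a single parent x, the chain follows two involutions: t x
    and the exchange of partners.  If f_i = y_j, the walk between the two visits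
    is a palindrome, and its middle is a fixed point of one of the involutions,
    which is impossible. *)
Lemma reach_star X A x k j f : pairing X A A k -> x \notin A ->
  f \in reach (fun=> [set x]) A A k j ->
  exists n a, n < j /\ chain a k A f (nseq n.+1 x).
Proof.
move=> Pk xA; pose g i := iter i (fun u => sib k (t x u)) f => fR.
have [n [nj [gA yA [ky kn]]]] : exists n, n < j /\ [/\ forall i, i <= n -> g i \in A,
    forall i, i <= n -> t x (g i) \in A &
    (forall i, i < n -> k (t x (g i)) != None) /\ k (t x (g n)) = None].
  rewrite {}/g; elim: j f fR => [|j IH] f /=; first by rewrite inE.
  rewrite inE => /andP[fA /existsP[z /and3P[/set1P-> yA kf]]].
  case: eqP kf => [ky _|/eqP ky /= /IH[n [nj [gA gyA [gk gn]]]]].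
    by exists 0; split => //; split => [[]|[]|] //.
  exists n.+1; split => //; split; first by case=> // i; rewrite iterSr => /gA.
    by case=> // i; rewrite iterSr => /gyA.
  split; last by rewrite iterSr.
  by case=> // i; rewrite iterSr => /gk.
(* The palindrome is shortened by one step at each end. *)
have neq d i : i + d <= n -> g (i + d) != t x (g i).
  elim/ltn_ind: d i => -[|[|d]] IH i.
  - by rewrite addn0 => /gA gi; rewrite eq_sym third_eq_r; apply: contraNneq xA => ->.
  - by rewrite addn1 => /ky; rewrite /g /= (sib_eq _ Pk).
  rewrite !addnS => idn; apply/eqP => /(congr1 (sib k)).
  rewrite {1}/g iterS (sibK Pk) -/(g _) -[sib k _]/(g i.+1).
  move/(congr1 (t x)); rewrite thirdK => e.
  have := IH d (ltnW _) i.+1; rewrite addSn ltnS e eqxx => /(_ (leqnn _)).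
  by move=> /(_ (ltnW idn)).
have neq2 i l : i <= n -> l <= n -> g l != t x (g i).
  move=> le_in le_ln; case: (leqP i l) => [il|/ltnW li].
    by rewrite -(subnKC il) neq // subnKC.
  apply/eqP => e; have := @neq (i - l) l; rewrite subnKC // => /(_ le_in).
  by rewrite e thirdK eqxx.
pose a : pred Q := fun u => u \in [seq g i | i <- iota 0 n.+1].
exists n, a; split => //.
have ag i : i <= n -> a (g i) by move=> ile; apply: map_f; rewrite mem_iota.
have ay i : i <= n -> ~~ a (t x (g i)).
  move=> ile; apply/mapP => -[l]; rewrite mem_iota ltnS => /= lle /esym/eqP.
  exact/negP/neq2.
suff ch d i : d + i = n -> chain a k A (g i) (nseq d.+1 x).
  by have := ch n 0; rewrite addn0; apply.
elim: d i => [|d IH] i.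
  by rewrite add0n => ->; rewrite /= ag // yA // ay // kn eqxx.
move=> dn; have ile : i <= n by lia.
rewrite -[nseq d.+2 x]/(x :: nseq d.+1 x) [chain _ _ _ _ _]/=.
rewrite ag // yA // ay //=; apply/orP; right.
by apply: (IH i.+1); rewrite addnS.
Qed.

(** Expansion forces an unused point of A1 into [reach].  As long as there is
    none, the partners of the points already reached are new targets, disjoint
    from the unused points of A2, so each round gains the number of unused
    points of A2 minus the error. *)
Lemma reach_growth (D : nat -> {set Q}) X A1 A2 k T err :
  A1 = A2 \/ [disjoint A1 & A2] -> pairing X A1 A2 k ->
  (forall j Z, j < T -> Z \subset A2 ->
     #|Z| <= #|[set f in A1 | [exists x in D j, t x f \in Z]]| + err) ->
  #|A1| + T * err < T * #|A2 :\: supp k| ->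
  exists f j, [/\ f \in A1, k f = None, j <= T & f \in reach D A1 A2 k j].
Proof.
move=> sides Pk Hexp big.
pose F := A2 :\: supp k; pose E j := reach D A1 A2 k j.
have step j : j < T -> [disjoint E j & ~: supp k] -> #|F| + #|E j| <= #|E j.+1| + err.
  move=> jT dE.
  have subE : {subset E j <= supp k}.
    by move=> f fE; have := disjointFr dE fE; rewrite inE => /negbFE.
  have -> : #|F| + #|E j| = #|F :|: sib k @: E j|.
    rewrite cardsU card_imset; last exact: inv_inj (sibK Pk).
    suff -> : F :&: sib k @: E j = set0 by rewrite cards0 subn0.
    apply/setP => u; rewrite in_set0; apply/negbTE/negP => /setIP[/setDP[_ uk] /imsetP[f fE uE]].
    by move: uk; rewrite uE (supp_sib _ Pk) subE.
  apply: leq_trans (Hexp _ _ jT _) _.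
    apply/subsetP => u /setUP[/setDP[]//|/imsetP[f fE ->]].
    have fA := subsetP (reach_sub _ _ _ _ _) _ fE.
    have := subE _ fE; rewrite inE /sib; case E': (k f) => [p|//] _.
    by have [_ _ _ _ [/(_ fA)]] := Pk _ _ E'.
  rewrite leq_add2r; apply: subset_leq_card; apply/subsetP => f.
  rewrite !inE => /andP[fA /existsP[x /andP[xD yZ]]]; rewrite fA /=.
  apply/existsP; exists x; rewrite xD /=.
  case/setUP: yZ => [/setDP[yA]|/imsetP[g gE ->]].
    by rewrite !inE => /negPn -> ; rewrite yA.
  rewrite (sibK Pk) -/(E j) gE orbT andbT.
  have := subE _ gE; rewrite inE /sib; case E': (k g) => [p|//] _.
  have gA := subsetP (reach_sub _ _ _ _ _) _ gE.
  by have [_ _ _ _ [/(_ gA)]] := Pk _ _ E'.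
case: (boolP [exists j : 'I_T.+1, ~~ [disjoint E j & ~: supp k]]) => [/existsP[j]|].
  rewrite -setI_eq0 => /set0Pn[f /setIP[fE]]; rewrite !inE negbK => /eqP kf.
  exists f, j; split => //; last exact: ltnSE (ltn_ord j).
  exact: subsetP (reach_sub _ _ _ _ _) _ fE.
rewrite negb_exists => /forallP disE.
have grow j : j <= T -> j * #|F| <= #|E j| + j * err.
  elim: j => [|j IH] jT; first by rewrite !mul0n.
  have := IH (ltnW jT); have := step j jT.
  have := disE (inord j); rewrite inordK ?ltnS ?(ltnW jT) // negbK => dE /(_ dE).
  by rewrite !mulSn; lia.
have := grow T (leqnn _); rewrite leqNgt => /negP[].
apply: leq_ltn_trans big; rewrite leq_add2r.
exact: subset_leq_card (reach_sub _ _ _ _ _).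
Qed.

Lemma pairing_augment (D : nat -> {set Q}) X A1 A2 k T err cap : [disjoint A1 & A2] ->
  pairing X A1 A2 k ->
  (forall j Z, j < T -> Z \subset A2 ->
     #|Z| <= #|[set f in A1 | [exists x in D j, t x f \in Z]]| + err) ->
  #|A1| + T * err < T * #|A2 :\: supp k| ->
  (forall j, j < T -> D j \subset X) ->
  (forall z, deg k z + (\sum_(j < T) (z \in D j)).*2 <= cap) ->
  exists k', [/\ pairing X A1 A2 k', forall z, deg k' z <= cap & #|supp k| < #|supp k'|].
Proof.
move=> dA Pk Hexp big DX dk.
have [f [j [fA kf jT /(reach_chain dA)[s [ch cs]]]]] := reach_growth (or_intror dA) Pk Hexp big.
have cT z : count_mem z s <= \sum_(j < T) (z \in D j).
  apply: leq_trans (cs z) _; rewrite -(subnKC jT) big_split_ord /=.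
  exact: leq_addr.
apply: (chain_augment (or_intror dA) Pk fA kf ch) => [z|z].
  rewrite -has_pred1 has_count => /leq_trans/(_ (cT z)).
  rewrite lt0n sum_nat_eq0 negb_forall => /existsP[i].
  by rewrite implyTb eqb0 negbK => /(subsetP (DX _ (ltn_ord i))).
by apply: leq_trans (dk z); rewrite leq_add2l leq_double.
Qed.

(** A single parent x outside A expands in A, with error #|~: A|, because t x is
    injective. *)
Lemma pairing_augment_star x X A k T cap : x \notin A -> x \in X ->
  pairing X A A k ->
  #|A| + T * #|~: A| < T * #|A :\: supp k| ->
  (forall z, deg k z <= cap) -> deg k x + T.*2 <= cap ->
  exists k', [/\ pairing X A A k', forall z, deg k' z <= cap & #|supp k| < #|supp k'|].
Proof.
move=> xA xX Pk big dk dx.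
have Hexp j Z : j < T -> Z \subset A ->
   #|Z| <= #|[set f in A | [exists y in [set x], t y f \in Z]]| + #|~: A|.
  move=> _ ZA; rewrite -(card_imset _ (@third_inj x)) -cardsUI.
  apply: leq_trans (leq_addr _ _); apply: subset_leq_card.
  apply/subsetP => _ /imsetP[z zZ ->]; rewrite !inE.
  case: (boolP (t x z \in A)) => //= _; rewrite orbF; apply/existsP; exists x.
  by rewrite set11 thirdK.
have [f [j [fA kf jT fR]]] := reach_growth (or_introl erefl) Pk Hexp big.
have [n [a [nj ch]]] := reach_star Pk xA fR.
apply: (chain_augment (or_introl erefl) Pk fA kf ch) => [z|z].
  by rewrite mem_nseq => /eqP->.
rewrite count_nseq /=; case: eqP => [<-|_]; last by rewrite mul0n addn0.
rewrite mul1n; apply: leq_trans dx; rewrite leq_add2l leq_double.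
exact: leq_trans nj jT.
Qed.
End Pairings.

(** * Fans, greedy completion, and trees of large degree *)

(** An improvement step that increases a bounded measure can be iterated until
    the goal G holds. *)
Lemma improve_until (T : Type) (P G : T -> Prop) (mu : T -> nat) (b : nat) (k0 : T) :
  (forall k, P k -> mu k <= b) ->
  (forall k, P k -> G k \/ exists2 k', P k' & mu k < mu k') ->
  P k0 -> exists2 k, P k & G k.
Proof.
move=> bound step; have [n] := ubnP (b - mu k0); elim: n k0 => // n IH k0 lt Pk0.
have [Gk|[k' Pk' lt']] := step k0 Pk0; first by exists k0.
have bd := bound _ Pk'; apply: (IH k') => //; lia.
Qed.

(** The numerical condition of [pairing_augment_star] for T = 2 a + 1 rounds, when
    u points are used, x of them are parents, each parent may receive d + T
    pairs, and f points of the other A = N - u remain unused. *)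
Lemma expansion_budget_large_degree a d u x N f A : 0 < a -> A + u = N -> x <= u ->
  u * d.*2 <= N -> a * (4 * a + 3) <= d -> a * (u + x * d.*2) + N <= a * N ->
  0 < N -> A <= f + x * (d.*2 + a.*2.+1.*2) -> A + a.*2.+1 * u < a.*2.+1 * f.
Proof.
rewrite -!muln2 => a0 AuN xu ud ad slack N0 Af.
have e0 := leq_mul (leqnn a) Af.
have e1 := leq_mul (leqnn (2 * a * (a * 2).+1)) xu.
have aA : a * A + a * u = a * N by rewrite -mulnDr AuN.
have e2 : N <= a * f + 2 * a * (a * 2).+1 * u by lia.
have e3 := leq_mul ad (leqnn (2 * u * a.+1)).
have e4 := leq_mul ud (leqnn a.+1).
have e5 := leq_mul (leqnn (a * 2).+1) e2.
have p1 : 0 < N * a by rewrite muln_gt0 N0.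
have p2 : 0 <= u * a by [].
have p3 : 0 <= u * a * a by [].
have [u0|up] := posnP u; first by rewrite -(ltn_pmul2l a0); rewrite {}u0 in e5 aA *; lia.
have p4 : 0 < u * a by rewrite muln_gt0 up.
rewrite -(ltn_pmul2l a0). clear -e3 e4 e5 aA p1 p2 p3 p4 N0. lia.
Qed.

Section Fans.
Variables (Q : finType) (t : steiner_op Q).
Implicit Types (x y u f : Q) (A O X Z U R : {set Q}).

(** d disjoint pairs for every x in X: the j-th pair of x consists of
    [g x j false] and [g x j true]. *)
Definition fan X d O (g : Q -> nat -> bool -> Q) : Prop :=
  [/\ forall x j b, x \in X -> j < d -> g x j b \in O,
      forall x j, x \in X -> j < d -> t x (g x j false) = g x j true &
      forall x j b x' j' b', x \in X -> j < d -> x' \in X -> j' < d ->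
        g x j b = g x' j' b' -> [/\ x = x', j = j' & b = b']].

(** One point from each pair of x, chosen by the enumeration of Q. *)
Definition lower_half (k : Q -> option Q) x :=
  [set u | (k u == Some x) && (enum_rank u < enum_rank (t x u))].

Lemma deg_lower_half X A1 A2 k x : pairing t X A1 A2 k -> deg k x = #|lower_half k x|.*2.
Proof.
move=> Pk; have -> : deg k x = #|lower_half k x :|: t x @: lower_half k x|.
  apply: eq_card => u; apply/idP/setUP => [|[|/imsetP[v vH ->]]].
  - rewrite inE => /eqP ku; have [_ ktu ne _ _] := Pk _ _ ku.
    case: (ltngtP (enum_rank u) (enum_rank (t x u))) => [lt|lt|/ord_inj/enum_rank_inj e].
    + by left; rewrite inE ku eqxx.
    + right; apply/imsetP; exists (t x u); last by rewrite thirdK.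
      by rewrite inE ktu eqxx thirdK.
    + by rewrite -e eqxx in ne.
  - by rewrite !inE => /andP[].
  - move: vH; rewrite !inE => /andP[/eqP kv _].
    by have [_ -> _ _ _] := Pk _ _ kv.
rewrite cardsU (card_imset _ (@third_inj _ t x)) addnn.
rewrite (_ : _ :&: _ = set0) ?cards0 ?subn0 //.
apply/setP => u; rewrite in_set0; apply/negbTE/negP => /setIP[uH /imsetP[v vH e]].
by move: uH vH; rewrite !inE e thirdK => /andP[_ /ltnW]; rewrite leqNgt => /negbTE ->; rewrite andbF.
Qed.

Lemma fan_of_pairing X A1 A2 k d : pairing t X A1 A2 k ->
  (forall x, x \in X -> d.*2 <= deg k x) -> exists g, fan X d (supp k) g.
Proof.
move=> Pk dk; pose H := lower_half k.
have HK x u : u \in H x -> k u = Some x by rewrite !inE => /andP[/eqP].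
have cH x : x \in X -> d <= #|H x|.
  by move=> xX; have := dk x xX; rewrite (deg_lower_half _ Pk) leq_double.
pose g x j (b : bool) := let u := nth x (enum (H x)) j in if b then t x u else u.
have gH x j : x \in X -> j < d -> g x j false \in H x.
  by move=> xX jd; rewrite -mem_enum mem_nth // -cardE (leq_trans jd (cH _ _)).
have gk x j b : x \in X -> j < d -> k (g x j b) = Some x.
  move=> xX jd; have := HK _ _ (gH x j xX jd); rewrite /g; case: b => //= ku.
  by have [_ ->] := Pk _ _ ku.
exists g; split => [x j b xX jd|//|x j b x' j' b' xX jd x'X j'd e].
  by rewrite inE gk.
have xx' : x = x' by have := gk x j b xX jd; rewrite e gk // => -[].
rewrite -{}xx' in e *.
have ltg i : i < d -> enum_rank (g x i false) < enum_rank (g x i true).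
  by move=> /(gH _ _ xX); rewrite inE => /andP[].
have inj i i' : i < d -> i' < d -> g x i false = g x i' false -> i = i'.
  move=> id i'd; rewrite /g => /eqP; rewrite nth_uniq ?enum_uniq -?cardE ?(leq_trans _ (cH _ xX)) //.
  by move/eqP.
have gt i : t x (g x i false) = g x i true by [].
have gt' i : t x (g x i true) = g x i false by rewrite -gt thirdK.
case: b b' e => [] [] e.
- by split => //; apply: inj => //; rewrite -!gt' e.
- have e2 : g x j false = g x j' true by rewrite -gt' e gt.
  by have := ltg _ jd; rewrite e e2 ltnNge ltnW ?ltg.
- have e2 : g x j true = g x j' false by rewrite -gt e gt'.
  by have := ltg _ jd; rewrite e e2 ltnNge ltnW ?ltg.
- by split => //; exact: inj.
Qed.

Lemma fan_sub X d O O' g : O \subset O' -> fan X d O g -> fan X d O' g.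
Proof. by move=> /subsetP sO [gO gt gi]; split => // x j b xX jd; apply/sO/gO. Qed.

Lemma pairing_sub X A1 A2 O k : A1 :|: A2 \subset O -> pairing t X A1 A2 k ->
  pairing t X O O k.
Proof.
move=> /subsetP sO Pk u x /[dup] ku /Pk[xX ktu ne uA _].
have [_ _ _ tuA _] := Pk _ _ ktu.
have [uO tuO] := (sO _ uA, sO _ tuA).
by split => //; rewrite setUid.
Qed.

Lemma supp_pairing X A1 A2 k : pairing t X A1 A2 k -> supp k \subset A1 :|: A2.
Proof.
move=> Pk; apply/subsetP => u; rewrite inE; case E: (k u) => [x|//] _.
by have [] := Pk _ _ E.
Qed.

Lemma deg_none x : deg (fun=> None : option Q) x = 0.
Proof. by apply: eq_card0 => u; rewrite inE. Qed.

Lemma maximal_pairing X A1 A2 cap (G : (Q -> option Q) -> Prop) :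
  (forall k, pairing t X A1 A2 k -> (forall x, deg k x <= cap) ->
    G k \/ exists k', [/\ pairing t X A1 A2 k', forall x, deg k' x <= cap & #|supp k| < #|supp k'|]) ->
  exists k, [/\ pairing t X A1 A2 k, forall x, deg k x <= cap & G k].
Proof.
move=> step.
have [|k [Pk dk]|//|k [Pk dk] Gk] := @improve_until _ (fun k => pairing t X A1 A2 k /\ forall x, deg k x <= cap)
  G (fun k => #|supp k|) #|Q| (fun=> None).
- by move=> k _; exact: max_card.
- have [|[k' [Pk' dk' lt]]] := step k Pk dk; first by left.
  by right; exists k'.
- by split => // x; rewrite deg_none.
- by exists k.
Qed.

(** If only the parents of D0 lack pairs, and each of them has many pairs inside
    the unused set R, then all can be completed inside R.  A parent receives at
    most 2 d + 1 points of R: 2 d + 1 rather than 2 d because the bound is not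
    rounded to an even number. *)
Lemma greedy_fill X A1 A2 k d (D0 R : {set Q}) : pairing t X A1 A2 k -> [disjoint A1 :|: A2 & R] ->
  D0 \subset X -> (forall x, x \in X -> x \notin D0 -> d.*2 <= deg k x) ->
  (forall x, x \in D0 -> (#|D0| * d.*2.+1).*2.+1 < #|[set u in R | t x u \in R]|) ->
  exists k', [/\ pairing t X (A1 :|: A2 :|: R) (A1 :|: A2 :|: R) k',
    forall x, x \in X -> d.*2 <= deg k' x & #|supp k' :&: R| <= #|D0| * d.*2.+1].
Proof.
move=> Pk dAR /subsetP D0X dk wR; set O := _ :|: R.
pose rdeg (k : Q -> option Q) x := #|[set u in R | k u == Some x]|.
pose P k := [/\ pairing t X O O k,
    forall x, x \in X -> x \notin D0 -> d.*2 <= deg k x &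
    forall x, rdeg k x <= (x \in D0) * d.*2.+1].
have rsupp k' : P k' -> #|supp k' :&: R| <= #|D0| * d.*2.+1.
  case=> Pk' _ rk.
  have -> : #|supp k' :&: R| = \sum_(x in X) rdeg k' x.
    rewrite -sum1_card (partition_big (fun u => odflt u (k' u)) (mem X)) /=; last first.
      move=> u; rewrite !inE; case E: (k' u) => [x|] //= _.
      by case: (Pk' _ _ E).
    apply: eq_bigr => x xX; rewrite /rdeg -sum1_card; apply: eq_bigl => u.
    rewrite !inE; case: (k' u) => [y|] /=; last by rewrite andbF.
    by rewrite andbC.
  apply: leq_trans (leq_sum _ (fun x _ => rk x)) _; rewrite -big_distrl /= leq_mul2r.
  apply/orP; right; apply: (@leq_trans (\sum_(x in X | x \in D0) 1)).
    by rewrite big_mkcondr; apply: leq_sum => x _; case: (x \in D0).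
  by rewrite sum1dep_card; apply: subset_leq_card; apply/subsetP => x; rewrite inE => /andP[].
have [k1 k1P|k1 k1P||k1 k1P dk1] := @improve_until _ P (fun k => forall x, x \in X -> d.*2 <= deg k x)
    (fun k => #|supp k|) #|Q| k; last first.
- by exists k1; split => //; [case: k1P|exact: rsupp].
- split => // [|x]; first by apply: pairing_sub Pk; exact: subsetUl.
  rewrite /rdeg eq_card0 // => u; rewrite !inE; apply/negbTE/negP => /andP[uR /eqP ku].
  have [_ _ _ uA _] := Pk _ _ ku.
  by have := disjointFr dAR uA; rewrite uR.
- case: (boolP [forall x in X, d.*2 <= deg k1 x]) => [/forall_inP dk1|]; first by left.
  rewrite negb_forall => /existsP[x]; rewrite negb_imply -ltnNge => /andP[xX dx]; right.
  have [Pk1 dk1 rk1] := k1P.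
  have xD : x \in D0 by apply: contraTT dx => /(dk1 _ xX); rewrite -leqNgt.
  (* B holds x and the points of R that are used or whose partner is used. *)
  pose B := x |: ((supp k1 :&: R) :|: t x @: (supp k1 :&: R)).
  have : #|B| < #|[set u in R | t x u \in R]|.
    apply: leq_ltn_trans (wR x xD); rewrite cardsU1.
    have := (leq_card_setU (supp k1 :&: R) (t x @: (supp k1 :&: R))).1.
    have := rsupp _ k1P; rewrite (card_imset _ (@third_inj _ t x)).
    case: (x \notin _) => /=; lia.
  move=> ltB; have /subsetPn[u uW uB] : ~~ ([set u in R | t x u \in R] \subset B).
    by apply: contraTN ltB => /subset_leq_card; rewrite -leqNgt.
  move: uW uB; rewrite inE !in_setU1 !inE !negb_or => /andP[uR yR] /and3P[ux uk yk].
  have ku : k1 u = None by move: uk; rewrite uR andbT negbK => /eqP.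
  have ky : k1 (t x u) = None.
    apply/eqP; apply: contraNT yk => ky; apply/imsetP; exists (t x u).
      by rewrite !inE ky.
    by rewrite thirdK.
  exists (insert_pair t k1 x u); last exact: card_supp_insert.
  split; first 2 last.
  - move=> z; have /= := deg_insert t k1 x u z.
    case: (eqVneq x z) => [<-|xz] dz.
      rewrite xD mul1n; apply: (@leq_trans (deg (insert_pair t k1 x u) x)).
        by apply: subset_leq_card; apply/subsetP => v; rewrite !inE => /andP[].
      by apply: leq_trans dz _; rewrite -[X in _ + X]/2 addn2 ltnS.
    apply: leq_trans (rk1 z); apply: subset_leq_card; apply/subsetP => v.
    rewrite !inE /insert_pair; case: ifP => // _ /andP[_ /eqP[] e].
    by rewrite e eqxx in xz.
  - apply: pairing_insert => //; last by left.
    + by rewrite third_eq_r eq_sym.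
    + by rewrite inE uR orbT.
    + by rewrite inE yR orbT.
  - move=> z zX zD; apply: leq_trans (dk1 z zX zD) _.
    apply: subset_leq_card; apply/subsetP => v; rewrite !inE /insert_pair.
    move=> /eqP kv; rewrite ifN ?kv //; apply/norP.
    by split; apply/eqP => e; rewrite e ?ku ?ky in kv.
- by move=> *; exact: max_card.
Qed.

(** Large degree: U is the set of all used points.  In a maximal pairing with at
    most d + T pairs for each parent, T = 2 a + 1, every parent has at least d
    pairs, since otherwise T further pairs would be allowed to it and it could
    serve as the single parent of an augmenting chain of T rounds. *)
Lemma large_degree_fan X U d a : 0 < a -> X \subset U ->
  #|U| * d.*2 <= #|Q| -> a * (4 * a + 3) <= d ->
  a * (#|U| + #|X| * d.*2) + #|Q| <= a * #|Q| ->
  0 < #|Q| ->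
  exists g, fan X d (~: U) g.
Proof.
move=> a0 XU Ud ad slack Q0.
pose T := a.*2.+1; pose cap := d.*2 + T.*2.
have [|k [Pk dk dX]] := @maximal_pairing X (~: U) (~: U) cap (fun k => forall x, x \in X -> d.*2 <= deg k x).
  move=> k Pk dk.
  case: (boolP [forall x in X, d.*2 <= deg k x]) => [/forall_inP dk1|]; first by left.
  rewrite negb_forall => /existsP[x]; rewrite negb_imply -ltnNge => /andP[xX dx]; right.
  apply: (@pairing_augment_star _ _ x X (~: U) k T cap) => //.
  - by rewrite inE negbK (subsetP XU).
  - have sk : #|supp k| <= #|X| * cap.
      by rewrite (card_supp Pk) -sum_nat_const; apply: leq_sum.
    have XleU := subset_leq_card XU.
    rewrite setCK.
    apply: (@expansion_budget_large_degree a d #|U| #|X| #|Q|) => //.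
      by rewrite -(cardsC (~: U)) setCK.
    rewrite -(cardsID (supp k) (~: U)) addnC leq_add2l; apply: leq_trans sk.
    by apply: subset_leq_card; exact: subsetIr.
  - by rewrite leq_add2r ltnW.
have [g gP] := fan_of_pairing Pk dX.
by exists g; apply: fan_sub gP; have := supp_pairing Pk; rewrite setUid.
Qed.

End Fans.

(** * A colouring with strong mixing, by a fourth moment *)

Section Mixing.
Import Order.TTheory GRing.Theory Num.Theory.
Variables (Q : finType) (t : steiner_op Q).
Implicit Types (x y u f v : Q) (D Z C : {set Q}).

(** The number of pairs (x, y) in D * Z such that t x y lies in C. *)
Definition hits D Z C : nat := \sum_(x in D) #|[set y in Z | t x y \in C]|.

Section Colouring.
Variable q : nat.
Local Notation colouring := {ffun Q -> 'I_q.+1}.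
Local Open Scope ring_scope.
Implicit Types (c : colouring) (k : 'I_q.+1).

(** The indicator function of colour k, centred and scaled to be integral. *)
Definition zeta k c v : int := q.+1%:Z * (c v == k)%:R - 1.

Lemma zeta_bound k c v : `|zeta k c v| <= q.+1%:Z.
Proof. by rewrite /zeta; case: eqP => _ /=; lia. Qed.

(** The value at v is centred and independent of the other values: the colours
    being the integers modulo q + 1, average over the shifts of the value at v. *)
Lemma sum_zeta k v (G : colouring -> int) :
  (forall c c', (forall u, u != v -> c u = c' u) -> G c = G c') ->
  \sum_c zeta k c v * G c = 0.
Proof.
move=> GP.
pose shift (j : 'I_q.+1) c : colouring := [ffun u => if u == v then c u + j else c u].
have shiftI j : injective (shift j).
  apply: (can_inj (g := shift (- j))) => c; apply/ffunP => u; rewrite !ffunE.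
  by case: eqP => // _; rewrite addrK.
have Gsh j c : G (shift j c) = G c.
  by apply: GP => u /negbTE uv; rewrite ffunE uv.
set S := \sum_c _.
have Sj j : \sum_c zeta k (shift j c) v * G c = S.
  by rewrite /S [RHS](reindex_inj (shiftI j)) /=; apply: eq_bigr => c _; rewrite Gsh.
suff : S *+ q.+1 = 0 by move/eqP; rewrite mulrn_eq0 => /eqP.
rewrite -[in LHS](card_ord q.+1) -sumr_const -(eq_bigr _ (fun j _ => Sj j)).
rewrite exchange_big big1 // => c _; rewrite -mulr_suml.
suff -> : \sum_(j : 'I_q.+1) zeta k (shift j c) v = 0 by rewrite mul0r.
rewrite sumrB sumr_const card_ord -mulr_sumr (bigD1 (k - c v)) //= big1 => [|j jk].
  by rewrite ffunE eqxx [c v + _]addrC subrK eqxx addr0 mulr1 -natz subrr.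
rewrite ffunE eqxx; case: eqP => // e; case/eqP: jk.
by rewrite -e addrC addKr.
Qed.

(** The inner product of the rows x and x' of the matrix zeta (t x f). *)
Definition correlation k c x x' : int := \sum_f zeta k c (t x f) * zeta k c (t x' f).
(** The sum of the squared correlations, the trace of the square of the Gram
    matrix. *)
Definition energy k c : int := \sum_x \sum_x' correlation k c x x' ^+ 2.

Lemma sum_eq_inj (h : Q -> Q) y : injective h -> (\sum_v (y == h v) <= 1)%N.
Proof.
move=> hI; have -> : (\sum_v (y == h v) = #|[set v | y == h v]|)%N.
  by rewrite -sum1dep_card [RHS]big_mkcond /=; apply: eq_bigr => v _; case: eqP.
apply/card_le1P => v; rewrite inE => /eqP yv u; rewrite !inE yv.
by apply/eqP/eqP => [/hI ->|->].
Qed.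

Lemma third_injl f : injective (t ^~ f).
Proof. by move=> x y; rewrite !(thirdC t _ f) => /third_inj. Qed.

(** A product of four values of zeta has mean 0 unless its first point coincides
    with another one.  There are #|Q| ^ 4 products, and each of the three possible
    coincidences determines one of the four indices x, x', f, f' from the other
    three. *)
Lemma fourth_moment k :
  \sum_c energy k c <= (3 * #|Q| ^ 3 * q.+1 ^ 4 * #|{: colouring}|)%N%:Z.
Proof.
pose I x x' f f' : nat := ((t x f == t x' f) + (t x f == t x f') + (t x f == t x' f'))%N.
pose K := (q.+1 ^ 4 * #|{: colouring}|)%N.
have E : \sum_c energy k c <= \sum_x \sum_x' \sum_f \sum_f' (I x x' f f' * K)%:R.
  rewrite exchange_big; apply: ler_sum => x _.
  rewrite exchange_big; apply: ler_sum => x' _.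
  under eq_bigr => c _ do rewrite expr2 big_distrlr /=.
  rewrite exchange_big; apply: ler_sum => f _.
  rewrite exchange_big; apply: ler_sum => f' _.
  have [I0|I1] := posnP (I x x' f f').
    rewrite I0 mul0n.
    under eq_bigr => c _ do rewrite -mulrA.
    rewrite sum_zeta // => c c' cc.
    move: I0; rewrite /I; case: eqP => // ab; case: eqP => // ac; case: eqP => // ad _.
    by rewrite /zeta !cc // eq_sym; apply/eqP.
  apply: (@le_trans _ _ (\sum_(c : colouring) (q.+1 ^ 4)%:R)).
    apply: ler_sum => c _; apply: le_trans (ler_norm _) _; rewrite !normrM.
    rewrite natrX (_ : q.+1%:R ^+ 4 = q.+1%:Z * q.+1%:Z * (q.+1%:Z * q.+1%:Z)); last by rewrite natz; ring.
    by rewrite !ler_pM ?mulr_ge0 ?zeta_bound.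
  by rewrite sumr_const -[_ *+ #|_|]mulr_natr -natrM ler_nat -/K leq_pmull.
apply: le_trans E _; rewrite -natz.
under eq_bigr => x _ do under eq_bigr => x' _ do under eq_bigr => f _ do rewrite -natr_sum.
under eq_bigr => x _ do under eq_bigr => x' _ do rewrite -natr_sum.
under eq_bigr => x _ do rewrite -natr_sum.
rewrite -natr_sum ler_nat.

rewrite (_ : (_ * _ * _ * _)%N = (3 * #|Q| ^ 3 * K)%N); last by rewrite /K mulnA.
under eq_bigr => x _ do under eq_bigr => x' _ do under eq_bigr => f _ do rewrite -big_distrl /=.
under eq_bigr => x _ do under eq_bigr => x' _ do rewrite -big_distrl /=.
under eq_bigr => x _ do rewrite -big_distrl /=.
rewrite -big_distrl /= leq_mul2r; apply/orP; right.
have N3 : (#|Q| ^ 3 = \sum_(x : Q) \sum_(x' : Q) \sum_(f : Q) 1)%N.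
  by rewrite !sum_nat_const muln1 !expnS expn0 muln1.
under eq_bigr => x _ do under eq_bigr => x' _ do under eq_bigr => f _ do rewrite big_split big_split /=.
under eq_bigr => x _ do under eq_bigr => x' _ do rewrite big_split big_split /=.
under eq_bigr => x _ do rewrite big_split big_split /=.
rewrite big_split big_split /= (_ : 3 * #|Q| ^ 3 = #|Q| ^ 3 + #|Q| ^ 3 + #|Q| ^ 3)%N; last first.
  by rewrite !mulSn mul0n addn0 addnA.
rewrite N3 !leq_add //; apply: leq_sum => x _.
- rewrite exchange_big [leqRHS]exchange_big; apply: leq_sum => f _.
  rewrite exchange_big; apply: leq_sum => f' _.
  exact/sum_eq_inj/third_injl.
- do 2 apply: leq_sum => ? _; exact/sum_eq_inj/third_inj.
- do 2 apply: leq_sum => ? _; exact/sum_eq_inj/third_inj.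
Qed.

Lemma energy_ge0 k c : 0 <= energy k c.
Proof. by do 2 apply: sumr_ge0 => ? _; exact: sqr_ge0. Qed.

Lemma low_energy_colouring : exists c, forall k,
  energy k c <= (3 * #|Q| ^ 3 * q.+1 ^ 5)%N%:R.
Proof.
set b := (_ * _)%N.
have sumE : \sum_c \sum_k energy k c <= \sum_(c : colouring) b%:R.
  rewrite exchange_big sumr_const -[leRHS]mulr_natr -natrM.
  apply: le_trans (ler_sum _ (fun k _ => fourth_moment k)) _.
  rewrite sumr_const card_ord -natz -[leLHS]mulr_natr -natrM ler_nat /b.
  by rewrite mulnAC -(mulnA _ _ q.+1) -expnSr.
have [c cP|no] := pickP (fun c => \sum_k energy k c <= b%:R).
  exists c => k; apply: le_trans cP; rewrite (bigD1 k) //= lerDl.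
  by apply: sumr_ge0 => *; exact: energy_ge0.
have c0 : colouring := [ffun=> 0].
have : \sum_(c : colouring) b%:R < \sum_c \sum_k energy k c.
  by apply: ltr_sum => [|c _]; [apply/hasP; exists c0; rewrite ?mem_index_enum|rewrite ltNge no].
by rewrite ltNge sumE.
Qed.

Lemma sqr_sum_le (I : finType) (A : {set I}) (F : I -> int) :
  (\sum_(i in A) F i) ^+ 2 <= #|A|%:R * \sum_(i in A) F i ^+ 2.
Proof.
have : 0 <= \sum_(i in A) \sum_(j in A) (F i - F j) ^+ 2.
  by do 2 apply: sumr_ge0 => ? _; exact: sqr_ge0.
have -> : \sum_(i in A) \sum_(j in A) (F i - F j) ^+ 2 =
    (#|A|%:R * \sum_(i in A) F i ^+ 2 - (\sum_(i in A) F i) ^+ 2) *+ 2.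
  rewrite [X in (_ - X)]expr2 big_distrlr /= mulr_sumr.
  transitivity (\sum_(i in A) (#|A|%:R * F i ^+ 2 + \sum_(j in A) F j ^+ 2 - (\sum_(j in A) F i * F j) *+ 2)).
    apply: eq_bigr => i _; rewrite mulr_natl -sumr_const -big_split -sumrMnl -sumrB /=.
    by apply: eq_bigr => j _; ring.
  rewrite sumrB big_split /= -mulr_sumr sumr_const sumrMnl -[in X in _ + X - _]mulr_natl.
  by rewrite mulr_sumr; ring.
by rewrite pmulrn_lge0 // subr_ge0.
Qed.

(** Two applications of the Cauchy-Schwarz inequality. *)
Lemma mixing_int c k D Z :
  (q.+1%:Z * (hits D Z [set v | c v == k])%:R - (#|D| * #|Z|)%:R) ^+ 4 <=
  #|D|%:R ^+ 2 * #|Z|%:R ^+ 2 * energy k c.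
Proof.
have -> : q.+1%:Z * (hits D Z [set v | c v == k])%:R - (#|D| * #|Z|)%:R =
    \sum_(f in Z) \sum_(x in D) zeta k c (t x f).
  rewrite exchange_big /hits natr_sum mulr_sumr -sum_nat_const natr_sum -sumrB.
  apply: eq_bigr => x _; rewrite sumrB -mulr_sumr sumr_const; congr (_ * _ - _).
  rewrite -sum1_card natr_sum big_mkcond [RHS]big_mkcond; apply: eq_bigr => y _.
  by rewrite !inE; case: (y \in Z); case: eqP.
set S := \sum_(f in Z) _.
pose W := \sum_(x in D) \sum_(x' in D) correlation k c x x'.
have S2 : S ^+ 2 <= #|Z|%:R * W.
  apply: le_trans (sqr_sum_le _ _) _; rewrite ler_wpM2l //.
  apply: (@le_trans _ _ (\sum_f (\sum_(x in D) zeta k c (t x f)) ^+ 2)).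
    rewrite [leRHS](bigID (mem Z)) /= lerDl.
    by apply: sumr_ge0 => *; exact: sqr_ge0.
  rewrite le_eqVlt; apply/orP; left; apply/eqP.
  under eq_bigr => f _ do rewrite expr2 big_distrlr /=.
  rewrite exchange_big; apply: eq_bigr => x _.
  by rewrite exchange_big.
have W2 : W ^+ 2 <= #|D|%:R ^+ 2 * energy k c.
  apply: le_trans (sqr_sum_le _ _) _; rewrite expr2 -mulrA ler_wpM2l //.
  rewrite /energy mulr_sumr.
  apply: (@le_trans _ _ (\sum_(x in D) #|D|%:R * \sum_x' correlation k c x x' ^+ 2)).
    apply: ler_sum => x _; apply: le_trans (sqr_sum_le _ _) _; rewrite ler_wpM2l //.
    rewrite [leRHS](bigID (mem D)) /= lerDl.
    by apply: sumr_ge0 => *; exact: sqr_ge0.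
  rewrite [leRHS](bigID (mem D)) /= lerDl.
  by apply: sumr_ge0 => *; rewrite mulr_ge0 // sumr_ge0 // => *; exact: sqr_ge0.
rewrite (_ : S ^+ 4 = (S ^+ 2) ^+ 2); last by ring.
apply: (@le_trans _ _ ((#|Z|%:R * W) ^+ 2)).
  by rewrite ler_sqr ?nnegrE ?sqr_ge0 // (le_trans (sqr_ge0 _) S2).
by rewrite exprMn [leRHS]mulrAC [leRHS]mulrC ler_wpM2l ?sqr_ge0.
Qed.

End Colouring.

(** For a large set of points, some colouring with q + 1 colours is mixing: the
    number of (x, y) in D * Z such that t x y has colour k differs from
    #|D| * #|Z| / (q + 1) by at most #|Q| ^ 2 / ((q + 1) H), for all D, Z and k. *)
Lemma mixing_colouring q H : (3 * q.+1 ^ 5 * H ^ 4 <= #|Q|)%N ->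
  exists c : Q -> 'I_q.+1, forall k D Z,
    (H * (q.+1 * hits D Z [set v | c v == k]) <= H * (#|D| * #|Z|) + #|Q| ^ 2)%N /\
    (H * (#|D| * #|Z|) <= H * (q.+1 * hits D Z [set v | c v == k]) + #|Q| ^ 2)%N.
Proof.
move=> big; have [c cP] := low_energy_colouring q; exists c => k D Z.
set e := hits _ _ _; pose s := (q.+1%:Z * e%:R - (#|D| * #|Z|)%:R)%R.
suff : (`|H%:R * s| <= (#|Q| ^ 2)%:R :> int)%R.
  rewrite {}/s; move: e (#|D| * #|Z|)%N (#|Q| ^ 2)%N => e m N; rewrite !natz; clear.
  nia.
rewrite -(@ler_pXn2r _ 4) ?nnegrE //.
rewrite -normrX ger0_norm; last by rewrite (_ : 4 = 2 * 2)%N // exprM sqr_ge0.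
rewrite exprMn -!natrX -expnM.
have DN : (#|D| <= #|Q|)%N by exact: max_card.
have ZN : (#|Z| <= #|Q|)%N by exact: max_card.
have cE := cP k; have E0 := energy_ge0 k c.
apply: le_trans (ler_wpM2l _ (mixing_int c k D Z)) _ => //.
apply: (@le_trans _ _ ((H ^ 4)%:R * (#|Q|%:R ^+ 2 * #|Q|%:R ^+ 2 * (3 * #|Q| ^ 3 * q.+1 ^ 5)%N%:R)))%R.
  have [DN' ZN'] : (#|D|%:R ^+ 2 <= #|Q|%:R ^+ 2 :> int)%R /\ (#|Z|%:R ^+ 2 <= #|Q|%:R ^+ 2 :> int)%R.
    by rewrite -!natrX !ler_nat !leq_exp2r.
  by rewrite ler_wpM2l // ler_pM ?mulr_ge0 ?exprn_ge0 // ler_pM ?exprn_ge0.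
rewrite -!natrX -!natrM ler_nat.
apply: (@leq_trans (#|Q| ^ 7 * (3 * q.+1 ^ 5 * H ^ 4))%N); last by rewrite (expnS _ 7) mulnC leq_mul2r big orbT.
by rewrite !expnS expn0; apply: eq_leq; lia.
Qed.
End Mixing.

(** * Expansion between blocks of colours, and trees of bounded degree *)

Lemma split_seq (I : finType) s T (l : seq I) : uniq l -> T * s <= size l ->
  exists D : nat -> {set I},
    (forall j, j < T -> D j \subset l /\ s <= #|D j|) /\
    forall z, \sum_(j < T) (z \in D j) <= (z \in l).
Proof.
elim: T l => [|T IH] l ul sl.
  by exists (fun=> set0); split => // z; rewrite big_ord0.
have [|D [DP Dz]] := IH (drop s l) (drop_uniq s ul).
  by rewrite size_drop; move: sl; rewrite mulSn; clear; lia.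
have ssl : s <= size l by apply: leq_trans sl; rewrite mulSn leq_addr.
exists (fun j => if j is i.+1 then D i else [set x in take s l]); split.
  case=> [_|j /DP[Dl sD]]; last first.
    by split => //; apply: subset_trans Dl _; apply/subsetP => x; exact: mem_drop.
  split; first by apply/subsetP => x; rewrite inE; exact: mem_take.
  by rewrite cardsE (card_uniqP (take_uniq s ul)) size_takel.
move=> z; rewrite big_ord_recl /=.
apply: leq_trans (leq_add (leqnn _) (Dz z)) _.
move: ul; rewrite -{1 4}(cat_take_drop s l) cat_uniq mem_cat inE => /and3P[_ /hasPn no _].
by case: (boolP (z \in drop s l)) => [/no/negbTE -> //|_]; rewrite ?orbF ?addn0.
Qed.

Lemma split_set (I : finType) s T (S : {set I}) : T * s <= #|S| ->
  exists D : nat -> {set I},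
    (forall j, j < T -> D j \subset S /\ s <= #|D j|) /\
    forall z, \sum_(j < T) (z \in D j) <= (z \in S).
Proof.
rewrite cardE => /(split_seq (enum_uniq _))[D [DP Dz]]; exists D; split.
  by move=> j /DP[/subsetP DS sD]; split => //; apply/subsetP => x /DS; rewrite mem_enum.
by move=> z; rewrite -[z \in S]mem_enum.
Qed.

(** In the next four lemmas, N is the number of points, p the number of colours
    and H the precision of the mixing.  Here r is the number of reserved colours,
    R that of reserved points, b that of poor points, and h counts the pairs of a
    poor point and a reserved point whose third point is reserved. *)
Lemma card_poor_points_bound a r H N h b R : 0 < N -> 0 < r -> 0 < a ->
  32 * a * (2 * a * r) * (2 * a * r) + 2 <= H ->
  r * (H * (b * R)) <= H * (2 * a * r * h) + r * (N * N) ->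
  r * (H * N) <= H * (2 * a * r * R) + r * N ->
  h * (8 * a * a) <= b * N ->
  8 * (2 * a * r) * (2 * a * r) * b <= N.
Proof.
move=> N0 r0 a0 HE m1 m2 m3.
have m1' : H * (b * R) <= 2 * a * H * h + N * N.
  by rewrite -(leq_pmul2l r0); move: m1; clear; lia.
have m2' : H * N <= 2 * a * H * R + N.
  by rewrite -(leq_pmul2l r0); move: m2; clear; lia.
have m4 : 4 * a * (H * (b * R)) <= H * b * N + 4 * a * N * N.
  have := leq_mul (leqnn H) m3; have := leq_mul (leqnn (4 * a)) m1'; clear; lia.
have m5 : 2 * b * H <= 2 * b + H * b + 4 * a * N.
  rewrite -(leq_pmul2l N0); have := leq_mul (leqnn (2 * b)) m2'; move: m4; clear; lia.
have m6 := leq_mul (leqnn b) HE.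
have : 4 * a * (8 * (2 * a * r) * (2 * a * r) * b) <= 4 * a * N.
  move: m5 m6; clear; lia.
by rewrite leq_pmul2l // muln_gt0 a0.
Qed.

(** Here s, z, e, b are the sizes of the parent set D, of Z, of its image E and of
    the set of excluded points; c is the number of colours of each block. *)
Lemma expansion_bound H s p N z e b c h1 h2 :
  0 < c -> 0 < s -> 0 < p -> 0 < H -> 16 * p * N <= H * s -> 8 * p * p * b <= N ->
  c * (H * (s * z)) <= H * (p * h1) + c * (N * N) ->
  h1 <= h2 + s * b ->
  H * (p * h2) <= c * (H * (s * e) + N * N) ->
  z <= e + N %/ (4 * p).
Proof.
move=> c0 s0 p0 H0 Hs pb m1 m2 m3.
have p1 : c * (H * (s * z)) <= c * (H * (s * e)) + c * (2 * (N * N)) + H * (p * (s * b)).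
  have := leq_mul (leqnn (H * p)) m2; move: m1 m3; clear; lia.
have p2 : H * (p * (s * b)) <= c * (H * (p * (s * b))) by exact: leq_pmull.
have p3 : H * (s * z) <= H * (s * e) + 2 * (N * N) + H * (p * (s * b)).
  by rewrite -(leq_pmul2l c0); move: p1 p2; clear; lia.
have p4 : (H * s) * (4 * p * z) <= (H * s) * (4 * p * e + N).
  have := leq_mul Hs (leqnn N); have := leq_mul (leqnn (H * s)) pb.
  move: (leq_mul (leqnn (8 * p)) p3); clear; lia.
have p5 : 4 * p * z <= 4 * p * e + N by move: p4; rewrite leq_pmul2l // muln_gt0 H0.
have p40 : 0 < 4 * p by rewrite muln_gt0.
case: (leqP z e) => [ze|/ltnW ez]; first exact: leq_trans ze (leq_addr _ _).
by rewrite -leq_subLR leq_divRL // mulnC mulnBr leq_subLR.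
Qed.

(** Here C is the size of a block, f the number of its points that are neither
    used nor excluded, sa that of its used points, and xd the number of pairs
    wanted. *)
Lemma free_vertices_bound H p N c C b f sa xd : 
  0 < p -> c <= p -> 4 * p <= H -> 8 * p * p * b <= N ->
  c * (H * N) <= H * (p * C) + c * N -> C <= f + sa + b -> sa <= xd -> 
  p * xd + N <= N * c -> N <= 2 * p * f.
Proof.
move=> p0 cp Hp pb m1 m2 m3 m4.
have H0 : 0 < H by apply: leq_trans Hp; rewrite muln_gt0.
have q1 : c * N <= p * C + N %/ 4.
  case: (leqP (c * N) (p * C)) => [/leq_trans->//|lt]; first exact: leq_addr.
  rewrite -leq_subLR leq_divRL // -(leq_pmul2l p0).
  have e1 : H * (c * N - p * C) <= c * N by rewrite mulnBr leq_subLR; move: m1; clear; lia.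
  have e2 := leq_mul Hp (leqnn (c * N - p * C)).
  have e3 := leq_mul cp (leqnn N).
  move: e1 e2 e3; clear; lia.
have q2 : 4 * (N %/ 4) <= N by rewrite mulnC leq_trunc_div.
have q3 : 4 * (p * b) <= N.
  by apply: leq_trans pb; rewrite -[X in _ <= X]mulnA leq_mul //; move: p0; clear; lia.
have q4 := leq_mul (leqnn p) m2. have q5 := leq_mul (leqnn p) m3.
move: q1 q2 q3 q4 q5 m4; clear; lia.
Qed.

(** In 4 p + 1 rounds the gains exceed the size A of the block. *)
Lemma growth_beats_error p N A f : 0 < N -> 0 < p -> A <= N -> N <= 2 * p * f ->
  A + (4 * p + 1) * (N %/ (4 * p)) < (4 * p + 1) * f.
Proof.
move=> N0 p0 AN Nf.
have p40 : 0 < 4 * p by rewrite muln_gt0.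
have q1 : 4 * p * (N %/ (4 * p)) <= N by rewrite mulnC leq_trunc_div.
have q2 := leq_mul (leqnn (4 * p + 1)) q1.
have q3 := leq_mul (leqnn (2 * (4 * p + 1))) Nf.
have q4 := leq_mul (leqnn (4 * p)) AN.
rewrite -(ltn_pmul2l p40); move: q2 q3 q4 N0; clear; lia.
Qed.

Section Blocks.
Variables (Q : finType) (t : steiner_op Q).
Implicit Types (x y u f v : Q) (D Z C X U R : {set Q}).

Lemma hitsU D Z C C' : [disjoint C & C'] ->
  hits t D Z (C :|: C') = hits t D Z C + hits t D Z C'.
Proof.
move=> dC; rewrite /hits -big_split; apply: eq_bigr => x _ /=.
rewrite -cardsUI [X in _ + X](_ : _ = 0) ?addn0.
  by apply: eq_card => y; rewrite !inE; case: (y \in Z).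
apply: eq_card0 => y; rewrite !inE; apply/negP => /andP[/andP[_ yC] /andP[_ yC']].
by rewrite (disjointFr dC yC) in yC'.
Qed.

Lemma hits_setT C : hits t setT setT C = #|Q| * #|C|.
Proof.
rewrite /hits -sum_nat_const; apply: eq_big => x; first by rewrite inE.
move=> _; rewrite -(card_imset _ (@third_inj _ t x)); apply: eq_card => y.
apply/imsetP/idP => [[z]|yC]; first by rewrite !inE => /= zC ->.
by exists (t x y); rewrite ?inE thirdK.
Qed.

Lemma hits_setD D Z C B : hits t D Z C <= hits t D Z (C :\: B) + #|D| * #|B|.
Proof.
rewrite -sum_nat_const /hits -big_split; apply: leq_sum => x _ /=.
rewrite -[X in _ + X](card_imset _ (@third_inj _ t x)).
apply: leq_trans (leq_card_setU _ _).1; apply: subset_leq_card.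
apply/subsetP => y; rewrite !inE => /andP[-> ->] /=; rewrite andbT.
case: (boolP (t x y \in B)) => //= yB; apply/imsetP; exists (t x y) => //.
by rewrite thirdK.
Qed.

Lemma hits_swap D Z A C : Z \subset C ->
  hits t D Z A <= hits t D [set f in A | [exists x in D, t x f \in Z]] C.
Proof.
move=> /subsetP ZC; apply: leq_sum => x xD.
rewrite -(card_imset _ (@third_inj _ t x)); apply: subset_leq_card.
apply/subsetP => _ /imsetP[y /setIdP[yZ yA] ->]; rewrite !inE yA thirdK ZC //= andbT.
by apply/existsP; exists x; rewrite xD thirdK.
Qed.

Variables (q : nat) (H : nat) (col : Q -> 'I_q.+1).
Let p := q.+1.
Let N := #|Q|.
Hypothesis mixing : forall k D Z,
    H * (p * hits t D Z [set v | col v == k]) <= H * (#|D| * #|Z|) + N ^ 2 /\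
    H * (#|D| * #|Z|) <= H * (p * hits t D Z [set v | col v == k]) + N ^ 2.

(** The points whose colour lies in the interval [o, o + c). *)
Definition block o c := [set v | o <= col v < o + c].

Lemma block_mixing o c D Z : o + c <= p ->
  H * (p * hits t D Z (block o c)) <= c * (H * (#|D| * #|Z|) + N ^ 2) /\
  c * (H * (#|D| * #|Z|)) <= H * (p * hits t D Z (block o c)) + c * N ^ 2.
Proof.
elim: c => [|c IH] ocp.
  rewrite (_ : hits _ _ _ _ = 0) ?muln0 //; apply: big1 => x _; apply: eq_card0 => y.
  by rewrite !inE addn0; case: leqP; rewrite ?andbF.
have [|IH1 IH2] := IH; first by rewrite ltnW // -addnS.
have [m1 m2] := mixing (inord (o + c)) D Z.
have E : block o c.+1 = block o c :|: [set v | col v == inord (o + c)].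
  apply/setP => v; rewrite !inE -val_eqE /= inordK; last by rewrite -addnS.
  by rewrite addnS ltnS (leq_eqVlt _ (o + c)) andb_orr orbC; case: eqP => [->|]; rewrite ?leq_addr ?andbF.
rewrite E hitsU; last first.
  rewrite -setI_eq0; apply/eqP/setP => v; rewrite !inE -val_eqE /= inordK; last by rewrite -addnS.
  by apply/negP => /andP[/andP[_ lt] /eqP e]; rewrite e ltnn in lt.
move: m1 m2 IH1 IH2; move: (hits _ _ _ _) (hits _ _ _ _) p N (#|D| * #|Z|) => h1 h2 p' N' m.
by move=> *; split; rewrite ?mulnDr ?mulSn; lia.
Qed.

Lemma card_block o c : o + c <= p -> 0 < N -> c * (H * N) <= H * (p * #|block o c|) + c * N.
Proof.
move=> ocp N0; have [_] := block_mixing setT setT ocp.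
rewrite hits_setT !cardsT -/N => m.
rewrite -(leq_pmul2l N0); move: m; rewrite -mulnn; clear; lia.
Qed.

(** The number of u in R whose partner with respect to x is again in R. *)
Definition returns R x := #|[set u in R | t x u \in R]|.

(** The points with few pairs inside R.  When R is a proportion 1 / (2 a) of all
    N points, N / (4 a ^ 2) returns are to be expected; half as many are required. *)
Definition poor_points a R := [set x | returns R x * (8 * a * a) < N].

Lemma card_poor_points a r : 0 < N -> 0 < r -> p = 2 * a * r -> 32 * a * p * p + 2 <= H ->
  8 * p * p * #|poor_points a (block 0 r)| <= N.
Proof.
move=> N0 r0 pE HE; set B := poor_points _ _.
have a0 : 0 < a by case: a pE {HE B} => //.
have rp : 0 + r <= p by rewrite pE add0n leq_pmull // muln_gt0 a0.
have [_ m1] := block_mixing B (block 0 r) rp.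
have m2 := card_block rp N0.
have m3 : hits t B (block 0 r) (block 0 r) * (8 * a * a) <= #|B| * N.
  rewrite /hits big_distrl -sum_nat_const /=; apply: leq_sum => x.
  by rewrite inE => /ltnW.
rewrite -mulnn pE in HE m1 m2 *.
exact: (card_poor_points_bound N0 r0 a0 HE m1 m2 m3).
Qed.

(** Count the pairs (x, z) in D * Z with t x z in the first block, once by mixing
    for Z, and once, after (x, z) |-> (x, t x z), by mixing for the image. *)
Lemma block_expansion o o' c s (D Z B : {set Q}) :
  0 < c -> o + c <= p -> o' + c <= p -> 0 < s -> s <= #|D| -> 0 < H ->
  16 * p * N <= H * s -> 8 * p * p * #|B| <= N ->
  Z \subset block o' c ->
  #|Z| <= #|[set f in block o c :\: B | [exists x in D, t x f \in Z]]| + N %/ (4 * p).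
Proof.
move=> c0 oc o'c s0 sD H0 Hs pB ZC; set E := [set _ in _ | _].
have [_ m1] := block_mixing D Z oc.
have m2 := hits_setD D Z (block o c) B.
have [m3 _] := block_mixing D E o'c.
have m4 := leq_trans m2 (leq_add (hits_swap D (block o c :\: B) ZC) (leqnn _)).
have Hs' : 16 * p * N <= H * #|D| by apply: leq_trans Hs _; rewrite leq_mul2l sD orbT.
apply: (expansion_bound c0 (leq_trans s0 sD) _ H0 Hs' pB _ m4) => //.
Qed.

Lemma returns_setD (R Y : {set Q}) x : returns R x <= returns (R :\: Y) x + #|Y :&: R|.*2.
Proof.
rewrite /returns -addnn addnA.
apply: (@leq_trans #|[set u in R :\: Y | t x u \in R :\: Y] :|: (Y :&: R) :|: t x @: (Y :&: R)|).
  apply: subset_leq_card; apply/subsetP => u; rewrite !inE => /andP[uR yR].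
  rewrite uR yR !andbT; case: (boolP (u \in Y)) => //= uY; rewrite ?orbT // orbF.
  case: (boolP (t x u \in Y)) => //= yY; apply/imsetP; exists (t x u).
    by rewrite inE yY.
  by rewrite thirdK.
apply: leq_trans (leq_card_setU _ _).1 _.
rewrite (card_imset _ (@third_inj _ t x)) leq_add2r.
exact: (leq_card_setU _ _).1.
Qed.

(** Bounded degree: the pairs join two fresh blocks with c colours each, except
    for fewer than T * s parents, which are completed in the reserve R0.  In a
    maximal pairing there are fewer than T * s deficient parents, since otherwise
    T disjoint sets of s deficient parents would give an augmenting chain that
    uses each parent at most once. *)
Lemma small_degree_fan (X U B R0 : {set Q}) d o c s :
  let T := 4 * p + 1 in
  0 < N -> 0 < s -> 4 * p <= H -> 16 * p * N <= H * s -> 8 * p * p * #|B| <= N ->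
  o + c + c <= p -> p * (d * #|X|) + N <= N * c ->
  [disjoint block o c :|: block (o + c) c & R0] ->
  [disjoint U & block o c :|: block (o + c) c] ->
  (forall x, x \in X -> (T * s * d.*2.+1).*2.+1 + #|U :&: R0|.*2 + #|B|.*2 < returns R0 x) ->
  exists (g : Q -> nat -> bool -> Q) O,
    [/\ fan t X d O g, [disjoint O & U], [disjoint O & B],
        O \subset (block o c :|: block (o + c) c) :|: R0 &
        #|O :&: R0| <= T * s * d.*2.+1].
Proof.
move=> T N0 s0 pH Hs pB ocp cX dR dU wX.
pose A1 := block o c :\: B; pose A2 := block (o + c) c :\: B.
have oc : o + c <= p by apply: leq_trans ocp; exact: leq_addr.
have H0 : 0 < H by apply: leq_trans pH; rewrite muln_gt0.
have c0 : 0 < c by case: (c) cX => //; rewrite muln0 leqn0 addn_eq0 (gtn_eqF N0) andbF.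
have dA : [disjoint A1 & A2].
  rewrite -setI_eq0; apply/eqP/setP => v; rewrite !inE; apply/negP.
  by move=> /and3P[/and3P[_ _ lt] _ /andP[ge _]]; move: (leq_trans lt ge); rewrite ltnn.
have [k [Pk dk few]] : exists k, [/\ pairing t X A1 A2 k, forall x, deg k x <= d.*2 &
    #|[set x in X | deg k x < d.*2]| < T * s].
  apply: maximal_pairing => k Pk dk.
  case: (ltnP #|[set x in X | deg k x < d.*2]| (T * s)) => [|/split_set[D [DP Dz]]]; first by left.
  right; apply: (@pairing_augment _ t D X A1 A2 k T (N %/ (4 * p)) d.*2) => //.
  - move=> j Z /DP[_ sD] ZA.
    exact: (block_expansion c0 oc ocp s0 sD H0 Hs pB (subset_trans ZA (subsetDl _ _))).
  - apply: growth_beats_error => //; first exact: max_card.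
    have sA : #|supp k :&: A2| <= d * #|X|.
      have i1 : #|supp k :&: A2| <= #|supp k :&: A1|.
        rewrite -(card_imset _ (inv_inj (sibK Pk))); apply: subset_leq_card.
        apply/subsetP => _ /imsetP[u /setIP[uk uA] ->].
        rewrite inE (supp_sib _ Pk) uk /=; move: uk; rewrite inE /sib.
        case E: (k u) => [x|//] _.
        by have [_ _ _ _ [_ ->]] := Pk _ _ E.
      have i2 : #|supp k :&: A1| + #|supp k :&: A2| <= #|supp k|.
        rewrite -(cardsID A1 (supp k)) leq_add2l; apply: subset_leq_card.
        apply/subsetP => u /setIP[uk uA]; rewrite !in_setD uk andbT.
        by rewrite -in_setD (disjointFl dA).
      have i3 : #|supp k| <= #|X| * d.*2.
        by rewrite (card_supp Pk) -sum_nat_const; apply: leq_sum.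
      by move: i1 i2 i3; rewrite -muln2; clear; lia.
    apply: (@free_vertices_bound H p N c #|block (o + c) c| #|B| _ _ _ _ _ pH pB _ _ sA cX) => //.
    + by apply: leq_trans ocp; rewrite leq_addl.
    + exact: card_block.
    + rewrite -(cardsID B (block (o + c) c)) addnC leq_add //; last first.
        exact/subset_leq_card/subsetIr.
      by rewrite -(cardsID (supp k) A2) addnC setIC.
  - by move=> j /DP[DX _]; apply: subset_trans DX _; apply/subsetP => x /setIdP[].
  - move=> z; apply: leq_trans (leq_add (leqnn _) (_ : _ <= (z \in [set x in X | deg k x < d.*2]).*2)) _.
      by rewrite leq_double.
    rewrite inE; case: (ltnP (deg k z) d.*2) => dz; last by rewrite andbF addn0.
    case: (z \in X) => /=; last by rewrite addn0 ltnW.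
    rewrite (deg_lower_half _ Pk) in dz *.
    by rewrite -doubleD leq_double addn1 -ltn_double.
set D0 := [set x in X | _] in few.
have D0X : D0 \subset X by apply/subsetP => x /setIdP[].
pose Y := U :|: B; pose R := R0 :\: Y.
have [||x xD|k' [Pk' dk' sk']] := @greedy_fill _ t X A1 A2 k d D0 R Pk _ D0X.
- rewrite disjoint_sym; apply: disjointWl (subsetDl _ _) _; rewrite disjoint_sym.
  by apply: disjointWl dR; apply: setUSS; exact: subsetDl.
- by move=> x xX; rewrite inE xX /= -leqNgt.
- have := wX x (subsetP D0X x xD); have := returns_setD R0 Y x; rewrite -/R.
  have : #|Y :&: R0| <= #|U :&: R0| + #|B|.
    rewrite setIUl; apply: leq_trans (leq_card_setU _ _).1 _.
    by rewrite leq_add2l; apply: subset_leq_card; exact: subsetIl.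
  have := leq_mul (ltnW few) (leqnn d.*2.+1).
  rewrite -/(returns R x); move: (returns R x) (returns R0 x) #|Y :&: R0| #|U :&: R0| #|B|.
  by move: (_ * d.*2.+1) (_ * d.*2.+1) => e1 e2 e3 e4 e5 e6 e7; clear; lia.
have [g gP] := fan_of_pairing Pk' dk'; exists g, (supp k').
have kO := supp_pairing Pk'; rewrite setUid in kO.
split => //.
- apply: disjointWl kO _; rewrite -setI_eq0; apply/eqP/setP => v; rewrite !inE.
  case: (boolP (v \in U)) => vU; last by rewrite andbF.
  by have := disjointFr dU vU; rewrite !inE => /norP[/negbTE -> /negbTE ->]; rewrite !andbF.
- apply: disjointWl kO _; rewrite -setI_eq0; apply/eqP/setP => v; rewrite !inE.
  by case: (v \in B); rewrite ?andbF ?orbT.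
- apply: subset_trans kO _; rewrite setUSS ?subsetDl //.
  by apply: setUSS; exact: subsetDl.
apply: leq_trans (leq_mul (ltnW few) (leqnn d.*2.+1)); apply: leq_trans sk'.
apply: subset_leq_card; apply/subsetP => v /setIP[vk vR]; rewrite inE vk /=.
have /setUP[vA|//] := subsetP kO _ vk.
have : v \in block o c :|: block (o + c) c.
  by apply: subsetP vA; apply: setUSS; exact: subsetDl.
by move/(disjointFr dR); rewrite vR.
Qed.
End Blocks.

(** * The structure of perfect hypertrees *)

(** Choice over a finite index type. *)
Lemma fin_choice (I : finType) (B : Type) (b0 : B) (P : I -> B -> Prop) :
  (forall i, exists b, P i b) -> exists F : I -> B, forall i, P i (F i).
Proof.
move=> ex; suff [F FP] : exists F : I -> B, forall i, i \in enum I -> P i (F i).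
  by exists F => i; apply: FP; rewrite mem_enum.
elim: (enum I) => [|i s [F FP]]; first by exists (fun=> b0).
have [b Pb] := ex i; exists (fun j => if j == i then b else F j) => j.
by rewrite inE; case: eqP => [-> _|_ /FP].
Qed.

Section Paths.
Variables (V : finType) (G : hypergraph V).
Implicit Types (x y z : V) (e : {set V}) (p q : seq ({set V} * V)) (E : {set {set V}}).

Lemma walk_cat x p q :
  walk G x (p ++ q) = walk G x p && walk G (last x (unzip2 p)) q.
Proof. by elim: p x => //= -[e y] p IH x; rewrite IH !andbA. Qed.

(** Adjacency by an edge of E. *)
Definition share_edge E : rel V := fun x y => [exists e in E, (x \in e) && (y \in e)].

Lemma share_edge_sym E : symmetric (share_edge E).
Proof. by move=> x y; apply: eq_existsb => e; rewrite [(x \in e) && _]andbC. Qed.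

(** Vertices connected by edges of E are joined by a path, with distinct vertices
    and distinct edges, all of whose edges are in E. *)
Lemma connect_is_path E x y : E \subset edges G -> connect (share_edge E) x y ->
  exists p, is_path G x y p /\ {subset unzip1 p <= E}.
Proof.
move=> /subsetP EG /connectP[s]; elim: s x => [|z s IH] x /=.
  by move=> _ ->; exists [::]; split => //; split.
move=> /andP[/existsP[e /and3P[eE xe ze]] zs yl].
have [p [[wp lp up ep] pE]] := IH z zs yl.
have [xp|xp] := boolP (x \in z :: unzip2 p).
  move: xp; rewrite inE => /predU1P[->|]; first by exists p.
  move=> /mapP[[f x'] /= fp xx']; rewrite -{}xx' in fp.
  move: fp wp lp up ep pE => /path.splitPr[p1 p2].
  rewrite walk_cat /unzip1 /unzip2 !map_cat last_cat /= => /and4P[_ _ _ /andP[_ w2]] l2 /andP[_].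
  rewrite !cat_uniq => /and3P[_ _ u2] /and3P[_ _ /= /andP[_ e2]] pE.
  exists p2; split => // f' f'p; apply: pE; rewrite mem_cat inE f'p !orbT //.
have [epp|epp] := boolP (e \in unzip1 p).
  move: epp => /mapP[[e' w] /= fp xx']; rewrite -{e'}xx' in fp.
  move: fp wp lp up ep pE xp => /path.splitPr[p1 p2].
  rewrite walk_cat /unzip1 /unzip2 !map_cat last_cat /= => /and4P[_ eG _ /andP[we w2]] l2 /andP[_].
  rewrite !cat_uniq => /and3P[_ _ u2] /and3P[_ _ /= e2] pE.
  rewrite inE mem_cat !negb_or => /and3P[_ _ xw2].
  exists ((e, w) :: p2); split.
    split => //=; first by rewrite eG xe we.
    by apply/andP; split; [rewrite inE negb_or | exact: u2].
  by move=> f' f'p; apply: pE; rewrite mem_cat; apply/orP; right.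
exists ((e, z) :: p); split.
  by split => //=; [rewrite EG // xe ze | apply/andP; split | rewrite epp ep].
by move=> f; rewrite inE => /predU1P[->|/pE].
Qed.

End Paths.

(** A vertex below the root is determined by its parent, the number of its edge
    among the d edges below the parent, and its place in that edge; and every edge
    consists of a parent and two children with the same edge number. *)
Definition addressing (W : finType) (T : hypergraph W) d h (L : nat -> {set W})
    (par : W -> W) (idx : W -> nat) (side : W -> bool) : Prop :=
  [/\ forall i u, i < h -> u \in L i.+1 -> par u \in L i /\ idx u < d,
      forall i u u', i < h -> u \in L i.+1 -> u' \in L i.+1 ->
        par u = par u' -> idx u = idx u' -> side u = side u' -> u = u' &
      forall e, e \in edges T -> exists i v u w,
        [/\ i < h, [/\ v \in L i, u \in L i.+1 & w \in L i.+1], e = [set v; u; w],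
            par u = v /\ par w = v &
            [/\ idx u = idx w, side u = false & side w = true]]].

Section Addressing.
Variables (W : finType) (T : hypergraph W) (d h : nat) (L : nat -> {set W}).
Variable (M : W -> {set {set W}}).
Hypothesis hT : hypertree T.
Hypothesis vT : verts T = \bigcup_(i < h.+1) L i.
Hypothesis dL : forall i j, i <= h -> j <= h -> i != j -> [disjoint L i & L j].
Hypothesis cL : forall i, i <= h -> #|L i| = (2 * d) ^ i.
Hypothesis M_out : forall v, (forall i, i < h -> v \notin L i) -> M v = set0.
Hypothesis M_edges : forall i v, i < h -> v \in L i -> M v \subset edges T.
Hypothesis cM : forall i v, i < h -> v \in L i -> #|M v| = d.
Hypothesis MP : forall i v e, i < h -> v \in L i -> e \in M v ->
  exists u w, [/\ u \in L i.+1, w \in L i.+1 & e = [set v; u; w]].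
Hypothesis MI : forall i v e f, i < h -> v \in L i -> e \in M v -> f \in M v ->
  e != f -> e :&: f = [set v].

Lemma level_uniq i j v : i <= h -> j <= h -> v \in L i -> v \in L j -> i = j.
Proof.
move=> ih jh vi vj; apply/eqP; apply: contraT => ij.
by rewrite (disjointFr (dL ih jh ij) vi) in vj.
Qed.

Lemma level_succ i j v : i <= j -> j < h -> v \in L i -> v \in L j.+1 -> False.
Proof.
move=> ij jh vi vj; have := level_uniq (leq_trans ij (ltnW jh)) jh vi vj => e.
by rewrite e ltnn in ij.
Qed.

Lemma M_level v e : e \in M v -> exists2 i, i < h & v \in L i.
Proof.
move=> eM; have [/existsP[i vi]|] := boolP [exists i : 'I_h, v \in L i]; first by exists i.
rewrite negb_exists => /forallP no; rewrite M_out ?inE // in eM.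
by move=> i ih; have := no (Ordinal ih).
Qed.

(** The edges that join the levels 0, ..., k. *)
Definition upto k := [set e | [exists v, [exists i : 'I_k, v \in L i] && (e \in M v)]].

Lemma uptoP k e : reflect (exists i v, [/\ i < k, v \in L i & e \in M v]) (e \in upto k).
Proof.
rewrite inE; apply: (iffP existsP) => [[v /andP[/existsP[i vi] eM]]|[i [v [ik vi eM]]]].
  by exists i, v.
by exists v; rewrite eM andbT; apply/existsP; exists (Ordinal ik).
Qed.

Lemma upto_edges k : k <= h -> upto k \subset edges T.
Proof.
move=> kh; apply/subsetP => e /uptoP[i [v [ik vi eM]]].
exact: subsetP (M_edges (leq_trans ik kh) vi) _ eM.
Qed.

Lemma upto_level k e x : k <= h -> e \in upto k -> x \in e -> exists2 j, j <= k & x \in L j.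
Proof.
move=> kh /uptoP[i [v [ik vi eM]]].
have [u [w [ui wi ->]]] := MP (leq_trans ik kh) vi eM.
rewrite !inE -orbA => /or3P[] /eqP ->; [exists i => //; exact: ltnW|by exists i.+1..].
Qed.

Lemma connect_uptoW k k' : k <= k' -> subrel (connect (share_edge (upto k))) (connect (share_edge (upto k'))).
Proof.
move=> kk'; apply: connect_sub => x y /existsP[e /and3P[/uptoP[i [v [ik vi eM]]] xe ye]].
apply: connect1; apply/existsP; exists e; rewrite xe ye !andbT.
by apply/uptoP; exists i, v; split => //; exact: leq_trans ik kk'.
Qed.

(** The vertices other than v in the edges from v to the next level. *)
Definition children v := \bigcup_(e in M v) (e :\ v).

Lemma childrenP v u : reflect (exists2 e, e \in M v & u != v /\ u \in e) (u \in children v).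
Proof.
apply: (iffP bigcupP) => [[e eM]|[e eM [uv ue]]].
  by rewrite !inE => /andP[uv ue]; exists e.
by exists e => //; rewrite !inE uv.
Qed.

Lemma children_level i v u : i < h -> v \in L i -> u \in children v -> u \in L i.+1.
Proof.
move=> ih vi /childrenP[e eM [uv]]; have [a [b [ai bi ->]]] := MP ih vi eM.
by rewrite !inE (negbTE uv) /= => /orP[] /eqP ->.
Qed.

Lemma card_edge e : e \in edges T -> #|e| = 3.
Proof. by case: hT => /(_ e). Qed.

Lemma card_children i v : i < h -> v \in L i -> #|children v| = 2 * d.
Proof.
move=> ih vi; rewrite /children.
have tI : trivIset [set e :\ v | e in M v].
  apply/trivIsetP => _ _ /imsetP[e eM ->] /imsetP[f fM ->] ne.
  have ef : e != f by apply: contraNneq ne => ->.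
  rewrite -setI_eq0; apply/eqP/setP => x; rewrite !inE.
  have := MI ih vi eM fM ef => /setP/(_ x); rewrite !inE.
  by case: (x =P v) => //= _ ->.
have inj : {in M v &, injective (fun e => e :\ v)}.
  move=> e f eM fM ef.
  have [a [b [_ _ ee]]] := MP ih vi eM; have [a' [b' [_ _ ff]]] := MP ih vi fM.
  by rewrite -(@setD1K _ v e) ?ee ?inE ?eqxx // -ee ef setD1K // ff !inE eqxx.
rewrite -cover_imset -(eqP tI) big_imset //=.
rewrite (eq_bigr (fun=> 2)) ?sum_nat_const ?(cM ih vi) 1?mulnC // => e eM.
have := card_edge (subsetP (M_edges ih vi) _ eM); rewrite (cardsD1 v).
by have [a [b [_ _ ->]]] := MP ih vi eM; rewrite !inE eqxx => -[].
Qed.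

(** If the vertices of level k have disjoint sets of children, these sets fill
    level k + 1, by counting. *)
Lemma cover_of k : k < h ->
  (forall v v' u, k < h -> v \in L k -> v' \in L k -> u \in children v -> u \in children v' -> v = v') ->
  L k.+1 = \bigcup_(v in L k) children v.
Proof.
move=> kh sepk.
apply/eqP; rewrite eq_sym eqEcard; apply/andP; split.
  by apply/bigcupsP => v vk; apply/subsetP => u; exact: children_level.
have tI : trivIset [set children v | v in L k].
  apply/trivIsetP => _ _ /imsetP[v vk ->] /imsetP[v' v'k ->] ne.
  rewrite -setI_eq0; apply: contraNT ne => /set0Pn[u /setIP[uv uv']].
  by rewrite (sepk v v' u).
have [d0|d0] := posnP d; first by rewrite cL // d0 muln0 exp0n.
have inj : {in L k &, injective children}.
  move=> v v' vk v'k e; have : 0 < #|children v| by rewrite (card_children kh vk) muln_gt0.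
  by case/card_gt0P => u uv; apply: (sepk v v' u) => //; rewrite -e.
rewrite -cover_imset -(eqP tI) big_imset //= (eq_bigr (fun=> 2 * d)).
  by rewrite sum_nat_const (cL kh) (cL (ltnW kh)) expnS mulnC.
by move=> v vk; exact: (card_children kh vk).
Qed.

(** By induction on k: level k is connected within the levels 0, ..., k, and its
    vertices have disjoint sets of children.  A common child of v and v' would
    give a second path from v to v', leaving the levels 0, ..., k. *)
Lemma levels_connected k : k <= h ->
  (forall x y, x \in L k -> y \in L k -> connect (share_edge (upto k)) x y) /\
  (forall v v' u, k < h -> v \in L k -> v' \in L k -> u \in children v -> u \in children v' -> v = v').
Proof.
have sep k' : k' <= h -> (forall x y, x \in L k' -> y \in L k' -> connect (share_edge (upto k')) x y) ->
  forall v v' u, k' < h -> v \in L k' -> v' \in L k' -> u \in children v -> u \in children v' -> v = v'.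
  move=> k'h conn v v' u kh vk v'k uv uv'; apply/eqP/negPn/negP => vv'.
  have uk := children_level kh vk uv.
  have nl x : x \in L k' -> x != u.
    by move=> xk; apply/eqP => xu; rewrite -xu in uk; exact: level_succ (leqnn _) kh xk uk.
  have [p [pP pE]] := connect_is_path (upto_edges k'h) (conn v v' vk v'k).
  move: uv uv' => /childrenP[e eM [uv ue]] /childrenP[f fM [uv' uf]].
  have eG := subsetP (M_edges kh vk) _ eM; have fG := subsetP (M_edges kh v'k) _ fM.
  have inV x : x \in L k' -> x \in verts T.
    by move=> xk; rewrite vT; apply/bigcupP; exists (Ordinal (k'h : k' < h.+1)).
  have ve : v \in e by have [a [b [_ _ ->]]] := MP kh vk eM; rewrite !inE eqxx.
  have v'f : v' \in f by have [a [b [_ _ ->]]] := MP kh v'k fM; rewrite !inE eqxx.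
  have ef : e != f.
    apply: contraNneq vv' => ef; move: v'f; rewrite -ef.
    have [a [b [ak bk ->]]] := MP kh vk eM; rewrite !inE -orbA => /or3P[] /eqP v'E; rewrite v'E //.
      by rewrite v'E in v'k; case: (level_succ (leqnn _) kh v'k ak).
    by rewrite v'E in v'k; case: (level_succ (leqnn _) kh v'k bk).
  have q2 : is_path T v v' [:: (e, u); (f, v')].
    split => //=; first by rewrite eG fG ve ue uf v'f.
      by rewrite !inE !negb_or nl // vv' eq_sym nl.
    by rewrite !inE ef.
  case: hT => _ _ _ /(_ v v' (inV _ vk) (inV _ v'k) vv')[q [_ qU]].
  have := pE e; rewrite -(qU _ pP) (qU _ q2) /= inE eqxx => /(_ isT) eU.
  have [j jk uj] := upto_level k'h eU ue.
  exact: level_succ jk kh uj uk.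
suff conn : k <= h -> forall x y, x \in L k -> y \in L k -> connect (share_edge (upto k)) x y.
  by move=> kh; split; [exact: conn|apply: sep kh (conn kh)].
elim: k => [|k IH] kh.
- move=> x y x0 y0; have /eqP := cL (leq0n h); rewrite expn0 => /cards1P[r rE].
  by move: x0 y0; rewrite rE !inE => /eqP -> /eqP ->.
- move=> x y xk yk; have conn := IH (ltnW kh); have sepk := sep k (ltnW kh) conn.
  have cover := cover_of kh sepk.
  have par z : z \in L k.+1 -> exists2 v, v \in L k & connect (share_edge (upto k.+1)) v z.
    rewrite cover => /bigcupP[v vk /childrenP[e eM [zv ze]]]; exists v => //.
    apply: connect1; apply/existsP; exists e; rewrite ze andbT; apply/andP; split.
      by apply/uptoP; exists k, v.
    by have [a [b [_ _ ->]]] := MP kh vk eM; rewrite !inE eqxx.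
  have [v vk vx] := par x xk; have [v' v'k v'y] := par y yk.
  have sy := sym_connect_sym (share_edge_sym (upto k.+1)).
  apply: connect_trans v'y; rewrite sy; apply: connect_trans vx.
  by rewrite sy; apply: (connect_uptoW (leqnSn k)); apply: conn.
Qed.

Lemma child_inj k v v' u : k < h -> v \in L k -> v' \in L k ->
  u \in children v -> u \in children v' -> v = v'.
Proof. by move=> kh; have [_] := levels_connected (ltnW kh); apply. Qed.

Lemma child_exists k u : k < h -> u \in L k.+1 -> exists2 v, v \in L k & u \in children v.
Proof.
move=> kh; rewrite cover_of //; last by move=> v v' u' *; exact: (@child_inj k v v' u').
by move=> /bigcupP[v]; exists v.
Qed.

Lemma connected_upto k x r : k <= h -> r \in L 0 -> x \in L k -> connect (share_edge (upto k)) r x.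
Proof.
elim: k x => [|k IH] x kh r0 xk; first by apply: (levels_connected kh).1.
have [v vk /childrenP[e eM [xv xe]]] := child_exists kh xk.
apply: connect_trans (connect_uptoW (leqnSn k) (IH v (ltnW kh) r0 vk)) _.
apply: connect1; apply/existsP; exists e; rewrite xe andbT; apply/andP; split.
  by apply/uptoP; exists k, v.
by have [a [b [_ _ ->]]] := MP kh vk eM; rewrite !inE eqxx.
Qed.

(** An edge outside [upto h] would give a second path between two of its vertices. *)
Lemma edges_upto : edges T = upto h.
Proof.
apply/eqP; rewrite eqEsubset upto_edges // andbT; apply/subsetP => e eT.
apply/negPn/negP => eU.
have /card_gt2P[x [y [z [[xe ye ze] [xy yz zx]]]]] : 2 < #|e| by rewrite card_edge.
have inV v : v \in e -> v \in verts T by exact: subsetP (edges_verts eT) v.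
have /cards1P[r rE] : #|L 0| == 1 by rewrite cL // expn0.
have conn v : v \in e -> connect (share_edge (upto h)) r v.
  move=> /inV; rewrite vT => /bigcupP[[i ih] _ /= vi].
  by apply: (connect_uptoW (ih : i <= h)); apply: connected_upto; rewrite ?rE ?inE.
have cxy : connect (share_edge (upto h)) x y.
  apply: connect_trans (conn y ye).
  by rewrite (sym_connect_sym (share_edge_sym _)) conn.
have [p [pP pE]] := connect_is_path (upto_edges (leqnn h)) cxy.
have q1 : is_path T x y [:: (e, y)] by split => //=; rewrite ?eT ?xe ?ye ?inE ?xy.
case: hT => _ _ _ /(_ x y (inV _ xe) (inV _ ye) xy)[q [_ qU]].
by have := pE e; rewrite -(qU _ pP) (qU _ q1) /= inE eqxx => /(_ isT); apply/negP.
Qed.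

(** Address of u: its parent, the edge to its parent, the number of that edge, and
    whether u comes after the other child in that edge.  The default values are
    irrelevant below the root. *)
Definition parent u := odflt u [pick v | u \in children v].
Definition parent_edge u := odflt set0 [pick e in M (parent u) | u \in e].
Definition slot u := index (parent_edge u) (enum (M (parent u))).
Definition later u := [exists w in parent_edge u, (w != parent u) && (enum_rank w < enum_rank u)].

Lemma parentP k v u : k < h -> v \in L k -> u \in children v -> parent u = v.
Proof.
move=> kh vk uv; rewrite /parent; case: pickP => [v' uv'|/(_ v)]; last by rewrite uv.
have /childrenP[e eM _] := uv'; have [j jh v'j] := M_level eM.
have ukk := children_level kh vk uv; have ujj := children_level jh v'j uv'.
have [ekj] := level_uniq kh jh ukk ujj; rewrite -ekj in v'j.
exact: child_inj kh v'j vk uv' uv.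
Qed.

Lemma parent_edgeP k v e u : k < h -> v \in L k -> e \in M v -> u \in e -> u != v -> parent_edge u = e.
Proof.
move=> kh vk eM ue uv; rewrite /parent_edge (parentP kh vk); last by apply/childrenP; exists e.
case: pickP => [f /andP[fM uf]|/(_ e)]; last by rewrite eM ue.
apply/eqP/negPn/negP => fe.
by have /setP/(_ u) := MI kh vk fM eM fe; rewrite !inE uf ue (negbTE uv).
Qed.

Lemma addressingP : addressing T d h L parent slot later.
Proof.
split.
- move=> i u ih ui; have [v vi uv] := child_exists ih ui.
  have /childrenP[e eM [uv' ue]] := uv.
  rewrite /slot (parent_edgeP ih vi eM ue uv') (parentP ih vi uv); split => //.
  by rewrite -(cM ih vi) cardE index_mem mem_enum.
- move=> i u u' ih ui u'i.
  have [v vi uv] := child_exists ih ui; have [v' v'i u'v] := child_exists ih u'i.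
  have /childrenP[e eM [uv1 ue]] := uv; have /childrenP[f fM [u'v1 u'f]] := u'v.
  rewrite /slot /later (parent_edgeP ih vi eM ue uv1) (parentP ih vi uv).
  rewrite (parent_edgeP ih v'i fM u'f u'v1) (parentP ih v'i u'v) => vv'; rewrite -{v'}vv' in v'i u'v fM u'v1 *.
  have eE : e \in enum (M v) by rewrite mem_enum.
  have fE : f \in enum (M v) by rewrite mem_enum.
  move=> /(congr1 (nth set0 (enum (M v)))); rewrite !nth_index // => ef; rewrite -{f fE fM}ef in u'f *.
  have [a [b [_ _ eab]]] := MP ih vi eM.
  move=> late; apply/eqP/negPn/negP => ne.
  have ev : e = [set v; u; u'].
    apply/eqP; rewrite eq_sym eqEcard (card_edge (subsetP (M_edges ih vi) _ eM)).
    apply/andP; split.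
      by apply/subsetP => x; rewrite !inE -orbA => /or3P[] /eqP -> //; rewrite eab !inE eqxx.
    by rewrite -setUA cardsU1 cards2 !inE negb_or eq_sym uv1 eq_sym u'v1 ne.
  have lt : (enum_rank u' < enum_rank u) = (enum_rank u < enum_rank u').
    have lateE x y : x != v -> y != v -> e = [set v; x; y] ->
        [exists w in e, (w != v) && (enum_rank w < enum_rank x)] = (enum_rank y < enum_rank x).
      move=> xv yv ->; apply/existsP/idP => [[w]|yx].
        rewrite !inE -orbA => /and3P[/or3P[]/eqP -> //]; first by rewrite eqxx.
        by rewrite ltnn.
      by exists y; rewrite !inE eqxx orbT yv.
    rewrite -(lateE u u') // -(lateE u' u) //.
    by rewrite ev -!setUA [[set u] :|: _]setUC.
  have : enum_rank u != enum_rank u' :> nat.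
    by apply: contraNneq ne => /ord_inj/enum_rank_inj ->.
  by move: lt; case: ltngtP.
- move=> e; rewrite edges_upto => /uptoP[i [v [ih vi eM]]].
  have [a [b [ai bi eab]]] := MP ih vi eM.
  have av : a != v by apply/eqP => av; rewrite av in ai; exact: level_succ (leqnn _) ih vi ai.
  have bv : b != v by apply/eqP => bv; rewrite bv in bi; exact: level_succ (leqnn _) ih vi bi.
  have ab : a != b.
    apply/eqP => ab; have := card_edge (subsetP (M_edges ih vi) _ eM).
    by rewrite eab ab -setUA setUid cards2; case: (_ != _).
  wlog lt : a b ai bi eab av bv ab / enum_rank a < enum_rank b.
    move=> wl; case: (ltngtP (enum_rank a) (enum_rank b)) => [|lt|/ord_inj/enum_rank_inj e'].
    - exact: wl.
    - apply: (wl b a) => //; last by rewrite eq_sym.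
      by rewrite eab -!setUA [[set a] :|: _]setUC.
    - by rewrite e' eqxx in ab.
  have ae : a \in e by rewrite eab !inE eqxx orbT.
  have be : b \in e by rewrite eab !inE eqxx orbT.
  have pa : parent a = v by apply: (parentP ih vi); apply/childrenP; exists e.
  have pb : parent b = v by apply: (parentP ih vi); apply/childrenP; exists e.
  have qa : parent_edge a = e by exact: parent_edgeP ih vi eM ae av.
  have qb : parent_edge b = e by exact: parent_edgeP ih vi eM be bv.
  exists i, v, a, b; split => //; split; rewrite /slot /later ?pa ?pb ?qa ?qb //.
    apply/existsP => -[w /and3P[we wv wa]]; move: we wv wa.
    rewrite {1}eab !inE -orbA => /or3P[] /eqP ->; first by rewrite eqxx.
      by rewrite ltnn.
    by rewrite ltnNge ltnW.
  by apply/existsP; exists a; rewrite ae av.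
Qed.

End Addressing.

Lemma perfect_addressing (W : finType) (T : hypergraph W) d h :
  perfect_hypertree_of_height d h T -> exists (L : nat -> {set W}) par idx side,
    [/\ verts T = \bigcup_(i < h.+1) L i,
        forall i j, i <= h -> j <= h -> i != j -> [disjoint L i & L j],
        forall i, i <= h -> #|L i| = (2 * d) ^ i &
        addressing T d h L par idx side].
Proof.
move=> [hT [L [vT dL cL LP]]].
pose P v (Mv : {set {set W}}) := ((forall i, i < h -> v \notin L i) -> Mv = set0) /\
  forall i, i < h -> v \in L i -> [/\ Mv \subset edges T, #|Mv| = d,
    forall e, e \in Mv -> exists u w, [/\ u \in L i.+1, w \in L i.+1 & e = [set v; u; w]] &
    forall e f, e \in Mv -> f \in Mv -> e != f -> e :&: f = [set v]].
have exM v : exists Mv, P v Mv.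
  have [/existsP[i vi]|] := boolP [exists i : 'I_h, v \in L i].
    have [Mv MvP] := LP i v (ltn_ord i) vi; exists Mv; split.
      by move/(_ i (ltn_ord i)); rewrite vi.
    move=> j jh vj; suff <- : i = j :> nat by [].
    apply/eqP; apply: contraT => ij.
    by rewrite (disjointFr (dL _ _ (ltnW (ltn_ord i)) (ltnW jh) ij) vi) in vj.
  rewrite negb_exists => /forallP no; exists set0; split => // j jh vj.
  by have := no (Ordinal jh); rewrite vj.
have [M MP] := fin_choice set0 exM.
exists L, (parent M), (slot M), (later M); split => //.
apply: addressingP => //.
- by move=> v; exact: (MP v).1.
- by move=> i v ih /((MP v).2 i ih)[].
- by move=> i v ih /((MP v).2 i ih)[].
- by move=> i v e ih /((MP v).2 i ih)[_ _ h3 _]; exact: h3.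
- by move=> i v e f ih /((MP v).2 i ih)[_ _ _ h4]; exact: h4.
Qed.

(** * Embedding level by level *)

(** The number of vertices in the levels 0, ..., i. *)
Definition tree_size d i := \sum_(j < i.+1) (2 * d) ^ j.

Lemma tree_sizeS d i : tree_size d i.+1 = tree_size d i + (2 * d) ^ i.+1.
Proof. by rewrite /tree_size big_ord_recr. Qed.

Lemma tree_size_monotone d i j : i <= j -> tree_size d i <= tree_size d j.
Proof.
elim: j => [|j IH]; first by rewrite leqn0 => /eqP->.
rewrite leq_eqVlt => /predU1P[->//|]; rewrite ltnS => /IH le.
by rewrite tree_sizeS; apply: leq_trans le (leq_addr _ _).
Qed.

Lemma tree_size_le d i : 0 < d -> tree_size d i <= 2 * (2 * d) ^ i.
Proof.
move=> d0; elim: i => [|i IH]; first by rewrite /tree_size big_ord1.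
rewrite tree_sizeS expnS; move: IH; move: (tree_size d i) (_ ^ i) => g e IH.
have : e <= d * e by exact: leq_pmull.
move: IH; clear; lia.
Qed.

Lemma tree_size_succ d i : tree_size d i * d.*2 < tree_size d i.+1.
Proof.
rewrite -mul2n; elim: i => [|i IH]; first by rewrite tree_sizeS /tree_size big_ord1 mul1n.
by rewrite tree_sizeS [X in _ < X]tree_sizeS mulnDl -expnSr -addSn leq_add2r.
Qed.

Section Embedding.
Variables (W : finType) (T : hypergraph W) (d h : nat) (L : nat -> {set W}).
Variables (par : W -> W) (idx : W -> nat) (side : W -> bool).
Hypothesis vT : verts T = \bigcup_(i < h.+1) L i.
Hypothesis dL : forall i j, i <= h -> j <= h -> i != j -> [disjoint L i & L j].
Hypothesis cL : forall i, i <= h -> #|L i| = (2 * d) ^ i.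
Hypothesis addr : addressing T d h L par idx side.

(** The vertices in the levels 0, ..., i. *)
Definition below i := \bigcup_(j < i.+1) L j.

Lemma belowS i : below i.+1 = below i :|: L i.+1.
Proof. by rewrite /below big_ord_recr. Qed.

Lemma disjoint_below i : i < h -> [disjoint below i & L i.+1].
Proof.
move=> ih; rewrite -setI_eq0; apply/eqP/setP => v; rewrite !inE.
apply/negP => /andP[/bigcupP[j _ vj] vi].
have ne : j != i.+1 :> nat by rewrite neq_ltn ltn_ord.
by rewrite (disjointFr (dL (leq_trans (ltnSE (ltn_ord j)) (ltnW ih)) ih ne) vj) in vi.
Qed.

Lemma card_below i : i <= h -> #|below i| = tree_size d i.
Proof.
elim: i => [|i IH] ih; first by rewrite /below /tree_size !big_ord1 cL.
rewrite belowS tree_sizeS cardsU (_ : _ :&: _ = set0) ?cards0 ?subn0 ?IH ?cL ?(ltnW ih) //.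
by apply/eqP; rewrite setI_eq0 disjoint_below.
Qed.

Lemma card_verts : #|verts T| = tree_size d h.
Proof. by rewrite vT -/(below h) card_below. Qed.

Lemma sub_below i j : j <= i -> L j \subset below i.
Proof. by move=> ji; apply/subsetP => v vj; apply/bigcupP; exists (Ordinal (ji : j < i.+1)). Qed.

(** The invariant Inv i U X relates the set U of used points and the image X of
    level i; a step may use any set O of new points that carries a fan and such
    that Inv holds for every possible next level inside O. *)
Lemma embed_levels (Q : finType) (t : steiner_op Q) (Inv : nat -> {set Q} -> {set Q} -> Prop) (x0 : Q) :
  Inv 0 [set x0] [set x0] ->
  (forall i U X, i < h -> Inv i U X -> X \subset U -> #|X| = (2 * d) ^ i -> #|U| = tree_size d i ->
    exists (g : Q -> nat -> bool -> Q) O, [/\ fan t X d O g, [disjoint O & U] &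
      forall Y : {set Q}, Y \subset O -> #|Y| = (2 * d) ^ i.+1 -> Inv i.+1 (U :|: Y) Y]) ->
  exists f : W -> Q, {in verts T &, injective f} /\
    forall e, e \in edges T -> exists v u w,
      [/\ e = [set v; u; w], v != u & t (f v) (f u) = f w].
Proof.
move=> I0 step; case: addr => [A1 A2 A3].
have main i : i <= h -> exists f : W -> Q, [/\ {in below i &, injective f},
    Inv i (f @: below i) (f @: L i) &
    forall j u w, j < i -> u \in L j.+1 -> w \in L j.+1 -> par u = par w ->
      idx u = idx w -> side u = false -> side w = true -> t (f (par u)) (f u) = f w].
  elim: i => [|i IH] ih.
    exists (fun=> x0).
    have /cards1P[r rE] : #|L 0| == 1 by rewrite cL // expn0.
    have im A : A = [set r] -> [set x0 | _ in A] = [set x0].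
      by move=> ->; rewrite imset_set1.
    have b0 : below 0 = L 0 by rewrite /below big_ord1.
    split => //; first by rewrite b0 rE => x y; rewrite !inE => /eqP -> /eqP ->.
    by rewrite b0 (im _ rE).
  have [f [fI fInv fE]] := IH (ltnW ih).
  set U := f @: below i in fInv; set X := f @: L i in fInv.
  have XU : X \subset U by apply: imsetS; exact: sub_below.
  have cX : #|X| = (2 * d) ^ i.
    rewrite card_in_imset ?cL ?(ltnW ih) // => x y xi yi.
    by apply: fI; exact: subsetP (sub_below (leqnn i)) _ _.
  have cU : #|U| = tree_size d i by rewrite card_in_imset // card_below // ltnW.
  have [g [O [[gO gt gI] OU OInv]]] := step i U X ih fInv XU cX cU.
  pose f' u := if u \in L i.+1 then g (f (par u)) (idx u) (side u) else f u.
  have f'b u : u \in below i -> f' u = f u.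
    by move=> ub; rewrite /f' (disjointFr (disjoint_below ih) ub).
  have f'L u : u \in L i.+1 -> f' u = g (f (par u)) (idx u) (side u) by rewrite /f' => ->.
  have parX u : u \in L i.+1 -> f (par u) \in X.
    by move=> ui; apply: imset_f; exact: (A1 i u ih ui).1.
  have idxd u : u \in L i.+1 -> idx u < d by move=> ui; exact: (A1 i u ih ui).2.
  have parb u : u \in L i.+1 -> par u \in below i.
    by move=> ui; apply: subsetP (sub_below (leqnn i)) _ (A1 i u ih ui).1.
  have f'O u : u \in L i.+1 -> f' u \in O.
    by move=> ui; rewrite f'L //; apply: gO; [exact: parX|exact: idxd].
  have f'inj : {in L i.+1 &, injective f'}.
    move=> u w ui wi; rewrite !f'L // => /gI[]; rewrite ?parX ?idxd //.
    by move=> /(fI _ _ (parb u ui) (parb w wi)) pp ii ss; exact: (A2 i).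
  have sepUO u w : u \in below i -> w \in L i.+1 -> f' u = f' w -> False.
    move=> ub wi e; have := f'O w wi; rewrite -e f'b // => uO.
    by have := disjointFr OU uO; rewrite imset_f.
  exists f'; rewrite belowS; split.
  - move=> u w /setUP[ub|ui] /setUP[wb|wi].
    + by rewrite !f'b //; exact: fI.
    + by move=> /(sepUO _ _ ub wi).
    + by move=> /esym/(sepUO _ _ wb ui).
    + exact: f'inj.
  - rewrite imsetU (_ : f' @: below i = U); last by apply: eq_in_imset.
    apply: OInv; first by apply/subsetP => _ /imsetP[u ui ->]; exact: f'O.
    by rewrite card_in_imset // cL.
  - move=> j u w; rewrite ltnS leq_eqVlt => /predU1P[->|ji] uj wj pp ii su sw.
      rewrite f'b ?parb // !f'L // -pp -ii su sw; apply: gt; [exact: parX|exact: idxd].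
    have jh : j < h by exact: ltn_trans ji ih.
    have pj : par u \in below i by apply: subsetP (sub_below (ltnW ji)) _ (A1 _ _ jh uj).1.
    rewrite !f'b //; first exact: (fE j).
      exact: subsetP (sub_below ji) _ wj.
    exact: subsetP (sub_below ji) _ uj.
have [f [fI _ fE]] := main h (leqnn h).
exists f; rewrite vT; split => // e /A3[i [v [u [w [ih [vi ui wi] ee [pu pw] [ii su sw]]]]]].
exists v, u, w; split => //; last by rewrite -pu; apply: (fE i) => //; rewrite pw.
apply/eqP => vu; rewrite vu in vi.
by have := disjointFr (dL (ltnW ih) ih (negbT (ltn_eqF (ltnSn i)))) vi; rewrite ui.
Qed.
End Embedding.

Section Reserve.
Variables (Q : finType) (t : steiner_op Q).

(** A level can be embedded greedily in the reserve R0, avoiding B, when it is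
    small. *)
Lemma reserve_fan (X U B R0 : {set Q}) d :
  (forall x, x \in X -> (#|X| * d.*2.+1).*2.+1 + #|U :&: R0|.*2 + #|B|.*2 < returns t R0 x) ->
  exists (g : Q -> nat -> bool -> Q) O,
    [/\ fan t X d O g, [disjoint O & U], [disjoint O & B] & O \subset R0].
Proof.
move=> wX; pose Y := U :|: B; pose R := R0 :\: Y.
have P0 : pairing t X set0 set0 (fun=> None) by [].
have [|x xX|x xX|k [Pk dk _]] := @greedy_fill _ t X set0 set0 _ d X R P0 _ (subxx X).
- by rewrite setU0 -setI_eq0 set0I.
- by move=> /negP.
- have := wX x xX; have := returns_setD t R0 Y x; rewrite -/R.
  have : #|Y :&: R0| <= #|U :&: R0| + #|B|.
    rewrite setIUl; apply: leq_trans (leq_card_setU _ _).1 _.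
    by rewrite leq_add2l; apply: subset_leq_card; exact: subsetIl.
  rewrite -/(returns t R x); move: (returns t R x) (returns t R0 x) #|Y :&: R0| #|U :&: R0| #|B|.
  by move: (_ * d.*2.+1) => e1 e2 e3 e4 e5 e6; clear; lia.
have [g gP] := fan_of_pairing Pk dk; exists g, (supp k).
have kO := supp_pairing Pk; rewrite setUid setU0 set0U in kO.
split => //.
- apply: disjointWl kO _; rewrite -setI_eq0; apply/eqP/setP => v; rewrite !inE.
  by case: (v \in U); rewrite ?andbF.
- apply: disjointWl kO _; rewrite -setI_eq0; apply/eqP/setP => v; rewrite !inE.
  by case: (v \in B); rewrite ?andbF ?orbT.
- exact: subset_trans kO (subsetDl _ _).
Qed.
End Reserve.

Section Constants.
Variables a d0 : nat.
(** Constants depending on a and on the bound d0 on the degree.  A level is late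
    if it has more than #|Q| / late_levels vertices, so there are at most late_levels
    of these.  The reserve consists of 4 * late_levels colours, a proportion
    1 / (2 a) of all.  The largest number of steps in a chain is rounds; with N points,
    N / scale is the size of the sets of deficient parents used in one round; the
    mixing error is N ^ 2 / precision; and threshold is the number of points from
    which a mixing colouring exists. *)
Definition late_levels := 256 * a * a.
Definition colours := 2 * a * (4 * late_levels).
Definition rounds := 4 * colours + 1.
Definition scale := d0.*2.+1 * (128 * a * a * late_levels * rounds).
Definition precision := 32 * colours * scale.
Definition threshold := 3 * colours ^ 5 * precision ^ 4.
End Constants.

Section Copy.
Variables (V : finType) (S : hypergraph V).
Hypothesis SS : steiner_triple_system S.
Local Notation Q := {x : V | x \in verts S}.

(** The third point of the triple through x and y. *)
Definition third_of (x y : Q) : Q :=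
  if x == y then x else
  odflt x [pick z : Q | [&& [set val x; val y; val z] \in edges S, z != x & z != y]].

Lemma third_spec x y : x != y ->
  [/\ [set val x; val y; val (third_of x y)] \in edges S, third_of x y != x & third_of x y != y].
Proof.
move=> xy; rewrite /third_of (negbTE xy); case: pickP => [z /and3P[] //|no].
have [S3 Su] := SS; have xy' : val x != val y by rewrite val_eqE.
have [e [[eS xe ye] _]] := Su _ _ (valP x) (valP y) xy'.
have : 0 < #|e :\ val x :\ val y|.
  have := S3 e eS; rewrite (cardsD1 (val x)) xe (cardsD1 (val y)) !inE.
  by rewrite (eq_sym (val y)) xy' ye !add1n => -[->].
case/card_gt0P => z; rewrite !inE => /and3P[zy zx ze].
have zS : z \in verts S by exact: subsetP (edges_verts eS) _ ze.
have := no (exist _ z zS); rewrite -!val_eqE /= zx zy !andbT.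
suff -> : [set val x; val y; z] = e by rewrite eS.
apply/eqP; rewrite eqEcard (S3 e eS) -setUA cardsU1 cards2 !inE negb_or xy' !(eq_sym _ z) zx zy /= andbT.
by apply/subsetP => w; rewrite !inE => /or3P[] /eqP ->.
Qed.

Lemma third_uniq x y z : x != y -> z != x -> z != y ->
  [set val x; val y; val z] \in edges S -> third_of x y = z.
Proof.
move=> xy zx zy eS; have [fS tx ty] := third_spec xy.
have [_ Su] := SS; have xy' : val x != val y by rewrite val_eqE.
have [e [_ eU]] := Su _ _ (valP x) (valP y) xy'.
have e1 : e = [set val x; val y; val z] by apply: eU; rewrite !inE !eqxx orbT.
have e2 : e = [set val x; val y; val (third_of x y)] by apply: eU; rewrite !inE !eqxx orbT.
have : val z \in e by rewrite e1 !inE eqxx orbT.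
rewrite e2 !inE !val_eqE (negbTE zx) (negbTE zy) /= => /eqP ->.
by [].
Qed.

Lemma third_ofxx x : third_of x x = x.
Proof. by rewrite /third_of eqxx. Qed.

Lemma third_ofC x y : third_of x y = third_of y x.
Proof.
case: (eqVneq x y) => [->//|xy].
have yx : y != x by rewrite eq_sym.
have [eS tx ty] := third_spec yx; apply: third_uniq => //.
by rewrite [[set val x; _]]setUC.
Qed.

Lemma third_ofK x : involutive (third_of x).
Proof.
move=> y; case: (eqVneq x y) => [->|xy]; first by rewrite !third_ofxx.
have [eS tx ty] := third_spec xy; apply: third_uniq; rewrite 1?eq_sym //.
by rewrite -setUA [[set val _; val y]]setUC setUA.
Qed.

Definition sts_op : steiner_op Q := SteinerOp third_ofC third_ofK third_ofxx.

(** An injective map on the vertices that sends edges to triples yields a copy. *)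
Lemma copy_of_embedding (W : finType) (T : hypergraph W) (f : W -> Q) :
  {in verts T &, injective f} ->
  (forall e, e \in edges T -> exists v u w,
     [/\ e = [set v; u; w], v != u & sts_op (f v) (f u) = f w]) ->
  contains_copy S T.
Proof.
move=> fI fE; pose F v := val (f v).
have ev : forall e, e \in [set F @: (e : {set W}) | e in edges T] -> e \subset F @: verts T.
  by move=> _ /imsetP[e eT ->]; apply: imsetS; exact: edges_verts.
exists (Hypergraph ev); split; [split=> /=|].
- by apply/subsetP => _ /imsetP[v _ ->]; exact: valP.
- apply/subsetP => _ /imsetP[e eT ->]; have [v [u [w [eE vu tw]]]] := fE e eT.
  have inT x : x \in e -> x \in verts T by exact: subsetP (edges_verts eT) x.
  have fvu : f v != f u.
    by apply: contraNneq vu => /fI -> //; apply: inT; rewrite eE !inE eqxx ?orbT.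
  have [eS _ _] := third_spec fvu.
  by rewrite eE !imsetU !imset_set1 /F -tw.
- exists F; split => //= x y xT yT /val_inj; exact: fI.
Qed.

End Copy.

(** * The two ranges of the degree *)

(** If w points are still wanted, u points are used and b points are excluded,
    each at most N / (64 a ^ 2), then a point with N / (8 a ^ 2) returns has enough of
    them. *)
Lemma reserve_suffices a N w u b ret : 0 < N -> 64 * a * a <= N ->
  64 * a * a * w <= N -> 64 * a * a * u <= N -> 64 * a * a * b <= N ->
  N <= ret * (8 * a * a) -> w.*2.+1 + u.*2 + b.*2 < ret.
Proof.
move=> N0 h1 hw hu hb hr; rewrite -(ltn_pmul2r (_ : 0 < 8 * a * a)); last first.
  by rewrite lt0n; apply: contraTneq hr => ->; rewrite muln0 -ltnNge.
apply: leq_trans hr; rewrite -!muln2; move: N0 h1 hw hu hb; clear; lia.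
Qed.

(** The number c of colours for each of the two blocks of a level with x * 2 d
    vertices: enough for half of the vertices with a surplus of one colour, and
    at most two colours more than the proportional share. *)
Lemma colours_for_level N p d x c : 0 < N -> c = p * (x * d.*2) %/ (2 * N) + 2 ->
  p * (d * x) + N <= N * c /\ 2 * (N * c) <= p * (x * d.*2) + 4 * N.
Proof.
move=> N0 cE; have N20 : 0 < 2 * N by rewrite muln_gt0.
have := ltn_ceil (p * (x * d.*2)) N20; have := leq_trunc_div (p * (x * d.*2)) (2 * N).
rewrite {}cE; move: (_ %/ _) => e; rewrite -!muln2; clear; lia.
Qed.

(** The colours do not run out: o colours have been used, g vertices are embedded,
    l late levels are done, and the next level has D vertices.  Rounding costs at
    most 4 colours per late level, in all no more than r. *)
Lemma colours_suffice a N p r K o c l g D : 0 < N -> 0 < a ->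
  p = 2 * a * r -> r = 4 * K -> N * o <= N * r + p * g + 4 * (N * l) ->
  2 * (N * c) <= p * D + 4 * N -> l.+1 * N <= K * (g + D) ->
  a * (g + D) + N <= a * N -> o + c + c <= p.
Proof.
move=> N0 a0 pE rE ho hc hl hg.
have gN : g + D <= N by rewrite -(leq_pmul2l a0); apply: leq_trans hg; exact: leq_addr.
have lK : l.+1 <= K.
  by rewrite -(leq_pmul2r N0); apply: leq_trans hl _; rewrite leq_mul2l gN orbT.
have aN0 : 0 < a * N by rewrite muln_gt0 a0.
rewrite -(leq_pmul2l aN0).
have e1 := leq_mul (leqnn a) ho; have e2 := leq_mul (leqnn a) hc.
have e3 := leq_mul (leqnn p) hg; have e4 := leq_mul (leqnn (4 * a * N)) lK.
have e5 : p * N = a * r * N + 4 * a * N * K by rewrite pE rE; clear; lia.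
move: e1 e2 e3 e4 e5; clear; lia.
Qed.

Section Assembly.
Variables (W : finType) (T : hypergraph W) (d h : nat).
Hypothesis hT : perfect_hypertree_of_height d h T.
Hypothesis d_gt0 : 0 < d.
Variables (Q : finType) (t : steiner_op Q) (a : nat).
Let N := #|Q|.
Hypothesis N_gt0 : 0 < N.
Hypothesis a_gt0 : 0 < a.
Hypothesis slack : a * #|verts T| + N <= a * N.

(** T is mapped injectively to Q, with edges sent to triples. *)
Definition embeds := exists f : W -> Q, {in verts T &, injective f} /\
    forall e, e \in edges T -> exists v u w,
      [/\ e = [set v; u; w], v != u & t (f v) (f u) = f w].

Lemma embed_large_degree : a * (4 * a + 3) <= d -> embeds.
Proof.
move=> ad; have [L [par [idx [side [vT dL cL addr]]]]] := perfect_addressing hT.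
have [x0 _] : exists x0 : Q, true.
  by have /card_gt0P[x0 _] := N_gt0; exists x0.
apply: (embed_levels vT dL cL addr (t := t) (Inv := fun _ _ _ => True) (x0 := x0)) => // i U X ih _ XU cX cU.
have gS : a * tree_size d i.+1 + N <= a * N.
  apply: leq_trans slack; rewrite leq_add2r leq_mul2l (card_verts vT dL cL) tree_size_monotone ?orbT //.
have [||g gP] := @large_degree_fan _ t X U d a a_gt0 XU _ ad _ N_gt0.
- rewrite cU; apply: leq_trans (ltnW (tree_size_succ d i)) _.
  by rewrite -(leq_pmul2l a_gt0); apply: leq_trans gS; exact: leq_addr.
- by rewrite cU cX -mul2n -expnSr -tree_sizeS.
by exists g, (~: U); split => //; rewrite -setI_eq0 setIC setICr.
Qed.

Lemma embed_small_degree d0 K q s G H : d <= d0 -> K = 256 * a * a -> q.+1 = 2 * a * (4 * K) ->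
  G = d0.*2.+1 * (128 * a * a * K * (4 * q.+1 + 1)) -> s = N %/ G -> H = 32 * q.+1 * G ->
  3 * q.+1 ^ 5 * H ^ 4 <= N -> embeds.
Proof.
move=> dd0 KE pE GE sE HE big.
have [col mix] := mixing_colouring t big.
have [L [par [idx [side [vT dL cL addr]]]]] := perfect_addressing hT.
set p := q.+1 in pE GE HE big mix *.
set r := 4 * K in pE; have rE : r = 4 * K by [].
pose R0 := block col 0 r; pose B := poor_points t a R0.
have p_gt0 : 0 < p by [].
have K_gt0 : 0 < K by rewrite KE !muln_gt0 a_gt0.
have r_gt0 : 0 < r by rewrite muln_gt0 K_gt0.
have G_gt0 : 0 < G by rewrite GE !muln_gt0 a_gt0 K_gt0 addn1.
have H_gt0 : 0 < H by rewrite HE !muln_gt0 p_gt0.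
have HN : H <= N.
  apply: leq_trans big; apply: (@leq_trans (H ^ 4)).
    by rewrite (expnS H 3) leq_pmulr // expn_gt0 H_gt0.
  by rewrite leq_pmull // muln_gt0 expn_gt0.
have GH : G <= H by rewrite HE leq_pmull // muln_gt0.
have s_gt0 : 0 < s by rewrite sE divn_gt0 // (leq_trans GH HN).
have sGN : s * G <= N by rewrite sE leq_trunc_div.
have NsG : N <= 2 * (s * G).
  have := ltn_ceil N G_gt0; rewrite -sE; have : G <= s * G by exact: leq_pmull.
  clear; lia.
have pH : 4 * p <= H.
  by rewrite HE; have := leq_mul (leqnn (32 * p)) G_gt0; clear; lia.
have Hs : 16 * p * N <= H * s.
  by rewrite HE; have := leq_mul (leqnn (16 * p)) NsG; clear; lia.
have aaG : 64 * a * a * p <= G.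
  rewrite GE -[X in X <= _]mul1n leq_mul //.
  have := leq_mul (leqnn (128 * a * a)) (leq_mul K_gt0 (leqnn (4 * p + 1))).
  clear; lia.
have HB : 32 * a * p * p + 2 <= H.
  have e0 : a * p <= a * a * p by rewrite -mulnA leq_mul // leq_pmull.
  rewrite HE; have := leq_mul (leqnn (32 * p)) aaG.
  have : 0 < a * a * p * p by rewrite !muln_gt0 a_gt0.
  have := leq_mul (leqnn p) e0.
  clear; lia.
have cB : 8 * p * p * #|B| <= N by exact: (card_poor_points mix).
have ap : 8 * a <= p by rewrite pE rE; move: K_gt0 => K0; have := leq_mul (leqnn (8 * a)) K0; clear; lia.
have aaB : 64 * a * a * #|B| <= N.
  apply: leq_trans cB; rewrite leq_mul2r; apply/orP; right.
  have := leq_mul ap ap; clear; lia.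
have aaN : 64 * a * a <= N.
  by apply: leq_trans (leq_trans aaG (leq_trans GH HN)); exact: leq_pmulr.
have retB x : x \notin B -> N <= returns t R0 x * (8 * a * a) by rewrite inE -leqNgt.
have [x0 x0R x0B] : exists2 x0, x0 \in R0 & x0 \notin B.
  apply/subsetPn; apply/negP => /subset_leq_card RB.
  have : B != setT.
    apply: contraTneq cB => ->; rewrite cardsT -ltnNge -/N -[X in X < _]mul1n ltn_pmul2r //.
    by move: p_gt0; clear; lia.
  rewrite -subTset => /subsetPn[x _ /retB].
  have : returns t R0 x <= #|R0|.
    by apply: subset_leq_card; apply/subsetP => u; rewrite inE => /andP[].
  move=> le1 le2; have : N <= #|B| * (8 * a * a).
    by apply: leq_trans le2 _; rewrite leq_mul2r (leq_trans le1 RB) orbT.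
  move: aaB N_gt0; clear; lia.
(* After level i, the colours below o are the reserved ones and those used by l
   late levels; each late level, and the early ones together, draw little on the
   reserve R0. *)
pose Inv i (U X : {set Q}) := [disjoint U & B] /\ exists o l,
  [/\ r <= o, forall v, v \in U -> col v < o, l * N <= K * tree_size d i,
      N * o <= N * r + p * tree_size d i + 4 * (N * l) &
      128 * a * a * K * #|U :&: R0| <= K * N + l * N].
have geoN i : i <= h -> a * tree_size d i + N <= a * N.
  move=> ih; apply: leq_trans slack.
  by rewrite leq_add2r leq_mul2l (card_verts vT dL cL) tree_size_monotone ?orbT.
have geoN' i : i <= h -> tree_size d i <= N.
  by move=> /geoN gi; rewrite -(leq_pmul2l a_gt0); apply: leq_trans gi; exact: leq_addr.
apply: (embed_levels vT dL cL addr (t := t) (Inv := Inv) (x0 := x0)).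
  split; first by rewrite disjoints1.
  exists r, 0; split => //.
  - by move=> v /set1P ->; move: x0R; rewrite inE.
  - by rewrite -addnA leq_addr.
  - rewrite mul0n addn0; apply: (@leq_trans (128 * a * a * K)).
      by rewrite -[X in _ <= X]muln1 leq_mul2l (leq_trans (subset_leq_card (subsetIl _ _))) ?cards1 ?orbT.
    rewrite mulnC leq_mul2l; apply/orP; right; apply: leq_trans HN; apply: leq_trans GH.
    apply: leq_trans aaG; have p2 : 2 <= p by apply: leq_trans ap; move: a_gt0; clear; lia.
    by have := leq_mul (leqnn (64 * a * a)) p2; clear; lia.
move=> i U X ih [UB [o [l [ro Uo lN No Ru]]]] XU cX cU.
have XB x : x \in X -> x \notin B by move=> xX; rewrite (disjointFr UB) // (subsetP XU).
have cX2 : #|X| * d.*2 = (2 * d) ^ i.+1 by rewrite cX -mul2n expnSr.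
have aaU : 64 * a * a * #|U :&: R0| <= N.
  have lK : l * N <= K * N.
    by apply: leq_trans lN _; rewrite leq_mul2l geoN' ?orbT // ltnW.
  rewrite -(leq_pmul2l K_gt0); move: Ru lK; clear; lia.
(* Early levels have at most N / K vertices, so they fit in the reserve. *)
have [early|late] := leqP ((2 * d) ^ i.+1 * K) N.
  have [|g [O [gP OU OB OR]]] := @reserve_fan _ t X U B R0 d.
    move=> x /XB/retB; apply: reserve_suffices => //.
    have : 2 * (#|X| * d.*2.+1) <= 3 * (#|X| * d.*2).
      by have := leq_mul (leqnn #|X|) d_gt0; rewrite -!muln2; clear; lia.
    rewrite cX2; move: early; rewrite KE; clear; move: (_ * d.*2.+1) (_ ^ _) => e1 e2 h1 h2.
    have := leq_mul (leqnn (a * a)) h2; move: h1; clear; lia.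
  exists g, O; split => // Y YO cY; split.
    by rewrite -setI_eq0 setIUl setU_eq0 !setI_eq0 UB (disjointWl YO OB).
  exists o, l; split => //.
  - by move=> v /setUP[/Uo//|/(subsetP YO)/(subsetP OR)]; rewrite inE => /leq_trans; apply.
  - by apply: leq_trans lN _; rewrite leq_mul2l tree_sizeS leq_addr orbT.
  - by apply: leq_trans No _; rewrite leq_add2r leq_add2l leq_mul2l tree_sizeS leq_addr orbT.
  - apply: leq_trans (leq_addr _ _); rewrite mulnC [X in _ <= X]mulnC mulnA leq_mul2r.
    apply/orP; right; apply: (@leq_trans (tree_size d i.+1 * (128 * a * a))).
      rewrite leq_mul2r tree_sizeS -cU -cY; apply/orP; right.
      apply: leq_trans (subset_leq_card (subsetIl _ _)) _; exact: (leq_card_setU _ _).1.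
    have := tree_size_le i.+1 d_gt0; move: early; rewrite KE; move: (tree_size _ _) (_ ^ _) => e1 e2 h1 h2.
    have := leq_mul (leqnn (a * a)) h2; move: h1; clear; lia.
(* A late level takes 2 c fresh colours. *)
pose c := p * (#|X| * d.*2) %/ (2 * N) + 2.
have [c1 c2] := colours_for_level N_gt0 (erefl c).
have lN' : l.+1 * N <= K * (tree_size d i + #|X| * d.*2).
  by rewrite cX2; move: lN late; clear; lia.
have ocp : o + c + c <= p.
  apply: (colours_suffice N_gt0 a_gt0 pE rE No c2 lN').
  by rewrite cX2 -tree_sizeS geoN.
have hw : 128 * a * a * K * ((4 * p + 1) * s * d.*2.+1) <= N.
  apply: leq_trans sGN; rewrite GE.
  have dd : d.*2.+1 <= d0.*2.+1 by rewrite ltnS leq_double.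
  by have := leq_mul (leqnn (128 * a * a * K * ((4 * p + 1) * s))) dd; clear; lia.
have [|||g [O [gP OU OB OR cO]]] := @small_degree_fan _ t q H col mix X U B R0 d o c s N_gt0 s_gt0 pH Hs cB ocp c1.
- rewrite -setI_eq0; apply/eqP/setP => v; rewrite !inE; apply/negP.
  move=> /andP[/orP[]/andP[ov _] /= vr]; move: (leq_trans vr ro); first by rewrite ltnNge ov.
  by rewrite ltnNge (leq_trans _ ov) // leq_addr.
- rewrite -setI_eq0; apply/eqP/setP => v; rewrite !inE; apply/negP.
  move=> /andP[/Uo vo /orP[]/andP[ov _]]; first by rewrite ltnNge ov in vo.
  by rewrite ltnNge (leq_trans _ ov) ?leq_addr in vo.
- move=> x /XB/retB; apply: reserve_suffices => //.
  apply: leq_trans hw; rewrite leq_mul2r; apply/orP; right.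
  by have := leq_mul (leqnn (128 * a * a)) K_gt0; clear; lia.
exists g, O; split => // Y YO cY; split.
  by rewrite -setI_eq0 setIUl setU_eq0 !setI_eq0 UB (disjointWl YO OB).
exists (o + c + c), l.+1; split.
- by apply: leq_trans ro _; rewrite -addnA leq_addr.
- move=> v /setUP[/Uo vo|/(subsetP YO)/(subsetP OR)].
    by apply: leq_trans vo _; rewrite -addnA leq_addr.
  rewrite !inE => /orP[/orP[]|] /andP[_ vo] //.
    by apply: leq_trans vo _; exact: leq_addr.
  by apply: leq_trans vo _; apply: leq_trans ro _; rewrite -addnA leq_addr.
- by rewrite tree_sizeS -cX2.
- by rewrite tree_sizeS -cX2; move: No c2; clear; lia.
have : #|(U :|: Y) :&: R0| <= #|U :&: R0| + (4 * p + 1) * s * d.*2.+1.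
  rewrite setIUl; apply: leq_trans (leq_card_setU _ _).1 _; rewrite leq_add2l.
  by apply: leq_trans cO; apply/subset_leq_card/setSI.
move: Ru hw; move: (_ * s * _) #|_ :&: R0| #|_ :&: R0| => w u u' Ru hw hu.
have := leq_mul (leqnn (128 * a * a * K)) hu; move: Ru hw; clear; lia.
Qed.

End Assembly.

(** * The theorem *)

Import Order.TTheory GRing.Theory Num.Theory.
Local Open Scope ring_scope.

(** The slack mu in integers: a is any integer above 1 + 1 / mu. *)
Lemma integral_slack (R : realType) (mu : R) : 0 < mu ->
  exists2 a : nat, (0 < a)%N & forall n N m : nat, (1 + mu) * n%:R <= N%:R -> (m <= n)%N ->
    (n <= N)%N /\ (a * m + N <= a * N)%N.
Proof.
move=> mu0; pose a := Num.bound (mu^-1 + 1).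
have aP : mu^-1 + 1 < a%:R by apply: archi_boundP; rewrite addr_ge0 // invr_ge0 ltW.
exists a.
  by rewrite -(ltr_nat R); apply: le_lt_trans aP; rewrite addr_ge0 // invr_ge0 ltW.
move=> n N m nN mn; split.
  rewrite -(ler_nat R); apply: le_trans nN; rewrite mulrDl mul1r lerDl.
  by rewrite mulr_ge0 // ltW.
rewrite -(ler_nat R) natrD !natrM.
have mN : m%:R <= n%:R :> R by rewrite ler_nat.
have amu : mu + 1 <= a%:R * mu.
  have := ltW aP; rewrite -(ler_pM2r mu0) mulrDl mulVf ?gt_eqF // mul1r.
  by rewrite addrC.
have m0 : 0 <= m%:R :> R by [].
have h1 : (1 + mu) * m%:R <= N%:R by apply: le_trans nN; rewrite ler_pM2l // addr_gt0.
rewrite -(ler_pM2r mu0).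
have N0 : 0 <= N%:R :> R by [].
have h2 : 0 <= (a%:R * mu - (mu + 1)) * (N%:R - m%:R).
  by rewrite mulr_ge0 ?subr_ge0 //; apply: le_trans h1; rewrite mulrDl mul1r lerDl mulr_ge0 // ltW.
nra.
Qed.

Theorem theorem1p3 (R : realType) (mu : R) (mu_gt0 : 0 < mu) :
  exists n0 : nat, forall n : nat, (n0 <= n)%N ->
    forall d : nat, (0 < d)%N ->
    forall (V W : finType) (S : hypergraph V) (T : hypergraph W),
      steiner_triple_system S ->
      (1 + mu) * n%:R <= #|verts S|%:R ->
      perfect_hypertree d T ->
      (#|verts T| <= n)%N ->
      contains_copy S T.
Proof.
have [a a0 slack] := integral_slack mu_gt0.
pose d0 := (a * (4 * a + 3))%N.
exists (threshold a d0).+1 => n n0n d d_gt0 V W S T SS nS [h hT] Tn.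
have [nN aS] := slack _ _ _ nS Tn.
have cQ : #|{: {x : V | x \in verts S}}| = #|verts S| by rewrite card_sig; apply: eq_card.
have N0 : (0 < #|{: {x : V | x \in verts S}}|)%N by rewrite cQ; apply: leq_trans nN; apply: leq_trans n0n.
rewrite -cQ in aS nN.
suff [f [fI fE]] : embeds T (sts_op SS) by exact: copy_of_embedding fI fE.
have [dd|dd] := leqP (a * (4 * a + 3)) d.
  exact: (embed_large_degree hT (sts_op SS) N0 a0 aS dd).
have p0 : (0 < colours a)%N by rewrite /colours /late_levels !muln_gt0 a0.
apply: (@embed_small_degree _ _ d h hT d_gt0 _ (sts_op SS) a N0 a0 aS d0 (late_levels a) (colours a).-1 _
   (scale a d0) (precision a d0)) => //; first exact: ltnW.
- by rewrite prednK.
- by rewrite prednK.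
- by rewrite prednK.
- by rewrite prednK //; apply: leq_trans nN; apply: leq_trans n0n; exact: leqnSn.
Qed.
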